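(* For all $\lambda,\nu,\mu\in\mathbb{R}$, the $\mathfrak{sl}(2)$-relative cohomology space $\mathrm{H}^1_{\mathrm{diff}}(\mathfrak{osp}(1|2),\mathfrak{sl}(2);\mathfrak{D}_{\lambda,\nu;\mu})$ is trivial (equal to $0$). That is, any 1-cocycle $\Upsilon\in Z^1_{\mathrm{diff}}(\mathfrak{osp}(1|2),\mathfrak{D}_{\lambda,\nu;\mu})$ is a coboundary over $\mathfrak{osp}(1|2)$ if and only if its restriction to $\mathfrak{sl}(2)$ is a coboundary over $\mathfrak{sl}(2)$.
   Context: The superspace $\mathbb{R}^{1|1}$ has an even coordinate $x$ and an odd coordinate $\theta$ ($\theta^2=0$). $C^\infty(\mathbb{R}^{1|1})$ consists of $F(x,\theta)=f_0(x)+f_1(x)\theta$ with $f_0,f_1\in C^\infty(\mathbb{R})$; $f_0$ is even, $f_1\theta$ is odd, $|\cdot|$ denotes parity, and $F'=\partial_xF$. Put $\eta=\partial_\theta+\theta\partial_x$, $\overline\eta=\partial_\theta-\theta\partial_x$. For $H\in C^\infty(\mathbb{R}^{1|1})$ put $X_H=H\partial_x+\frac12\eta(H)\overline\eta$; these contact vector fields satisfy $[X_F,X_G]=X_{\{F,G\}}$ with $\{F,G\}=FG'-F'G+\frac12\eta(F)\overline\eta(G)$. The Lie superalgebra $\mathfrak{osp}(1|2)$ is the span of $X_1,X_x,X_{x^2}$ (even) and $X_\theta,X_{x\theta}$ (odd); its even part, the span of $X_1,X_x,X_{x^2}$, is identified with $\mathfrak{sl}(2)$. For $\lambda\in\mathbb{R}$,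 $\mathfrak{F}_\lambda=\{F\alpha^\lambda : F\in C^\infty(\mathbb{R}^{1|1})\}$, $\alpha=dx+\theta d\theta$, is identified with $C^\infty(\mathbb{R}^{1|1})$ with action $\mathfrak{L}^\lambda_{X_H}(F)=X_H(F)+\lambda H'F$. $\mathfrak{D}_{\lambda,\nu;\mu}$ is the superspace of bilinear differential operators $A:\mathfrak{F}_\lambda\otimes\mathfrak{F}_\nu\to\mathfrak{F}_\mu$ (finite order, coefficients in $C^\infty(\mathbb{R}^{1|1})$), with action $X_H\cdot A=\mathfrak{L}^\mu_{X_H}\circ A-(-1)^{|A||H|}A\circ\mathfrak{L}^{(\lambda,\nu)}_{X_H}$, where $\mathfrak{L}^{(\lambda,\nu)}_{X_H}(F\otimes G)=\mathfrak{L}^\lambda_{X_H}(F)\otimes G+(-1)^{|H||F|}F\otimes\mathfrak{L}^\nu_{X_H}(G)$. Let $\mathfrak g$ be a Lie superalgebra acting on a superspace $V$ and $\mathfrak h\subset\mathfrak g$ a subalgebra. The $\mathfrak h$-relative cochains are $C^n(\mathfrak g,\mathfrak h;V)=\mathrm{Hom}_{\mathfrak h}(\Lambda^n(\mathfrak g/\mathfrak h);V)$ (if $\mathfrak h$ is omitted it is $\{0\}$); in particular $C^0(\mathfrak g,\mathfrak h;V)=V^{\mathfrak h}=\{v\in V: h\cdot v=0\ \forall h\in\mathfrak h\}$. The coboundary is $\delta v(g)=(-1)^{|g||v|}g\cdot v$ in degree $0$ and, in degree $1$, $\delta\Upsilon(g,h)=(-1)^{|g||\Upsilon|}g\cdot\Upsilon(h)-(-1)^{|h|(|g|+|\Upsilon|)}h\cdot\Upsilon(g)-\Upsilon([g,h])$.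 $Z^1=\ker\delta$, $B^1=\operatorname{im}\delta$, $\mathrm{H}^1=Z^1/B^1$. The subscript ''diff'' means that only cochains given by differential operators are considered. *)

(* Defs.v *)
From HB Require Import structures.
From mathcomp Require Import all_boot all_order all_algebra.
From mathcomp Require Import all_classical all_reals all_analysis.
From mathcomp Require Import ring.
Import Order.TTheory GRing.Theory Num.Theory.
Import numFieldNormedType.Exports.

Set Implicit Arguments.
Unset Strict Implicit.
Unset Printing Implicit Defensive.

Local Open Scope classical_set_scope.
Local Open Scope ring_scope.

Section SmoothFunctions.
Variable R : realType.
Implicit Types f g : R -> R.

Definition smooth f := forall n x, derivable (derive1n n f) x 1.

Fixpoint smoothn n f : Prop :=
  (forall x, derivable f x 1) /\ if n is m.+1 then smoothn m (derive1 f) else True.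

Lemma smoothnP f : smooth f <-> forall n, smoothn n f.
Proof.
split=> [+ n|].
  elim: n f => [|n IH] f sf; first by split=> // x; exact: (sf 0%N).
  split; first by move=> x; exact: (sf 0%N).
  by apply: IH => m x; rewrite -derive1Sn; exact: sf.
move=> sf n; elim: n f sf => [|n IH] f sf x; first by case: (sf 0%N).
by rewrite derive1Sn; apply: IH => m; case: (sf m.+1).
Qed.

Lemma smoothn_derivable n f : smoothn n f -> forall x, derivable f x 1.
Proof. by case: n => [|n] []. Qed.

Lemma smoothnS n f : smoothn n.+1 f -> smoothn n f.
Proof. by elim: n f => [|n IH] f [df sf]; split=> //; exact: IH. Qed.

Lemma derive1_funD f g : (forall x, derivable f x 1) ->
  (forall x, derivable g x 1) -> (derive1 (f + g)) = (derive1 f) + (derive1 g).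
Proof.
by move=> df dg; apply/funext => x; rewrite !derive1E deriveD // -!derive1E.
Qed.

Lemma derive1_funM f g : (forall x, derivable f x 1) ->
  (forall x, derivable g x 1) -> (derive1 (f * g)) = (derive1 f) * g + f * (derive1 g).
Proof.
move=> df dg; apply/funext => x; rewrite derive1E deriveM // -!derive1E.
by rewrite addrC /= mulrC [X in _ = X]/=; congr (_ + _).
Qed.

Lemma derive1_funcst (k : R) : (derive1 (cst k : R -> R)) = cst 0.
Proof. by apply/funext => x; rewrite derive1_cst. Qed.

Lemma smoothnD n f g : smoothn n f -> smoothn n g -> smoothn n (f + g).
Proof.
elim: n f g => [|n IH] f g [df sf] [dg sg]; split=> //.
- by move=> x; exact: derivableD.
- by move=> x; exact: derivableD.
- by rewrite derive1_funD //; exact: IH.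
Qed.

Lemma smoothnM n f g : smoothn n f -> smoothn n g -> smoothn n (f * g).
Proof.
elim: n f g => [|n IH] f g sf sg.
  case: sf sg => [df _] [dg _]; split=> // x; exact: derivableM.
have [df sf'] := sf; have [dg sg'] := sg.
split; first by move=> x; exact: derivableM.
by rewrite derive1_funM //; apply: smoothnD; apply: IH => //; exact: smoothnS.
Qed.

Lemma smooth_cst (k : R) : smooth (cst k).
Proof.
apply/smoothnP => n; elim: n k => [|n IH] k; split=> //.
by rewrite derive1_funcst; exact: IH.
Qed.

Lemma smooth_id : smooth (id : R -> R).
Proof.
apply/smoothnP => -[|n]; split=> //.
suff -> : (derive1 (id : R -> R)) = cst 1 by have /smoothnP := @smooth_cst 1; exact.
by apply/funext => x; rewrite derive1_id.
Qed.

Lemma smoothD f g : smooth f -> smooth g -> smooth (f + g).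
Proof. by move=> /smoothnP sf /smoothnP sg; apply/smoothnP => n; exact: smoothnD. Qed.

Lemma smoothM f g : smooth f -> smooth g -> smooth (f * g).
Proof. by move=> /smoothnP sf /smoothnP sg; apply/smoothnP => n; exact: smoothnM. Qed.

Lemma smooth_derive1 f : smooth f -> smooth (derive1 f).
Proof. by move=> sf n x; rewrite -derive1Sn; exact: sf. Qed.

Definition smooth_pred : {pred R -> R} := fun f => `[< smooth f >].

Lemma smooth_subring : subring_closed smooth_pred.
Proof.
have sM f g : f \in smooth_pred -> g \in smooth_pred -> f * g \in smooth_pred.
  by move=> /asboolP sf /asboolP sg; apply/asboolP; exact: smoothM.
split=> //; first by apply/asboolP; exact: smooth_cst.
move=> f g /asboolP sf /asboolP sg; apply/asboolP.
rewrite -(mulN1r g); apply: smoothD => //; apply: smoothM => //.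
exact: (@smooth_cst (-1)).
Qed.

HB.instance Definition _ :=
  GRing.isSubringClosed.Build (R -> R) smooth_pred smooth_subring.

Lemma smooth_scaler : GRing.scaler_closed smooth_pred.
Proof.
move=> k f /asboolP sf; apply/asboolP.
by apply: (smoothM (@smooth_cst k)).
Qed.

HB.instance Definition _ :=
  GRing.isScaleClosed.Build R (R -> R) smooth_pred smooth_scaler.

Record Cinf := MkCinf { cfun :> R -> R; _ : cfun \in smooth_pred }.

HB.instance Definition _ := [isSub for cfun].
HB.instance Definition _ := [Choice of Cinf by <:].
HB.instance Definition _ := [SubChoice_isSubComNzRing of Cinf by <:].
HB.instance Definition _ := [SubNmodule_isSubLSemiModule of Cinf by <:].


Lemma cfunP (f g : Cinf) : (forall x, f x = g x) -> f = g.
Proof. by move=> fg; apply/val_inj/funext. Qed.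

Lemma cfun_smooth (f : Cinf) : smooth f.
Proof. by case: f => f /= /asboolP. Qed.

Definition cderiv (f : Cinf) : Cinf :=
  MkCinf (introT (asboolP _) (smooth_derive1 (@cfun_smooth f))).

Definition cX : Cinf := MkCinf (introT (asboolP _) smooth_id).

Lemma cfun_derivable (f : Cinf) x : derivable f x 1.
Proof. exact: (@cfun_smooth f 0%N). Qed.

Lemma cderivD (f g : Cinf) : cderiv (f + g) = cderiv f + cderiv g.
Proof. by apply/val_inj/derive1_funD; exact: cfun_derivable. Qed.

Lemma cderivM (f g : Cinf) : cderiv (f * g) = cderiv f * g + f * cderiv g.
Proof. by apply/val_inj/derive1_funM; exact: cfun_derivable. Qed.

Lemma cderivZ k (f : Cinf) : cderiv (k *: f) = k *: cderiv f.
Proof.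
apply: cfunP => x /=; rewrite derive1E deriveZ -?derive1E //.
exact: cfun_derivable.
Qed.

Lemma cderivX : cderiv cX = 1.
Proof. by apply: cfunP => x /=; rewrite derive1_id. Qed.

Lemma cderiv1 : cderiv 1 = 0.
Proof. by apply/val_inj; exact: derive1_funcst. Qed.

Lemma cderiv0 : cderiv 0 = 0.
Proof. by apply/val_inj; exact: derive1_funcst. Qed.

Lemma cscaleE k (f : Cinf) x : (k *: f) x = k * f x. Proof. by []. Qed.
Lemma caddE (f g : Cinf) x : (f + g) x = f x + g x. Proof. by []. Qed.
Lemma coppE (f : Cinf) x : (- f) x = - f x. Proof. by []. Qed.
Lemma cmulE (f g : Cinf) x : (f * g) x = f x * g x. Proof. by []. Qed.
Lemma cXE x : cX x = x. Proof. by []. Qed.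
Lemma c1E x : (1 : Cinf) x = 1. Proof. by []. Qed.
Lemma c0E x : (0 : Cinf) x = 0. Proof. by []. Qed.

Definition cE := (cscaleE, caddE, coppE, cmulE, cXE, c1E, c0E).

End SmoothFunctions.

Section SuperFunctions.
Variable R : realType.
Local Notation Cinf := (Cinf R).

(* [SuperFun f0 f1] is f0(x) + f1(x) theta. *)
Record superfun := SuperFun { sf0 : Cinf; sf1 : Cinf }.

Definition sf_pair F := (sf0 F, sf1 F).
Definition pair_sf (u : Cinf * Cinf) := SuperFun u.1 u.2.
Lemma sf_pairK : cancel sf_pair pair_sf. Proof. by case. Qed.

HB.instance Definition _ := Choice.copy superfun (can_type sf_pairK).

Lemma superfunP (F G : superfun) : sf0 F = sf0 G -> sf1 F = sf1 G -> F = G.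
Proof. by case: F G => [? ?] [? ?] /= -> ->. Qed.

Definition sf_zero := SuperFun 0 0.
Definition sf_add F G := SuperFun (sf0 F + sf0 G) (sf1 F + sf1 G).
Definition sf_opp F := SuperFun (- sf0 F) (- sf1 F).

Fact sf_addA : associative sf_add.
Proof. by move=> F G H; apply: superfunP; rewrite /= addrA. Qed.
Fact sf_addC : commutative sf_add.
Proof. by move=> F G; apply: superfunP; rewrite /= addrC. Qed.
Fact sf_add0 : left_id sf_zero sf_add.
Proof. by move=> F; apply: superfunP; rewrite /= add0r. Qed.
Fact sf_addN : left_inverse sf_zero sf_opp sf_add.
Proof. by move=> F; apply: superfunP; rewrite /= addNr. Qed.

HB.instance Definition _ :=
  GRing.isZmodule.Build superfun sf_addA sf_addC sf_add0 sf_addN.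

(* Even functions commute with theta and theta^2 = 0; with a single odd
   coordinate, the supercommutative product is thus commutative. *)
Definition sf_one := SuperFun 1 0.
Definition sf_mul F G :=
  SuperFun (sf0 F * sf0 G) (sf0 F * sf1 G + sf1 F * sf0 G).

Fact sf_mulA : associative sf_mul.
Proof. by move=> F G H; apply: superfunP => /=; ring. Qed.
Fact sf_mulC : commutative sf_mul.
Proof. by move=> F G; apply: superfunP => /=; ring. Qed.
Fact sf_mul1 : left_id sf_one sf_mul.
Proof. by move=> F; apply: superfunP => /=; ring. Qed.
Fact sf_mulDl : left_distributive sf_mul sf_add.
Proof. by move=> F G H; apply: superfunP => /=; ring. Qed.
Fact sf_one_neq0 : sf_one != 0.
Proof. by apply/eqP => -[/eqP]; rewrite oner_eq0. Qed.

HB.instance Definition _ := GRing.Zmodule_isComNzRing.Build superfun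
  sf_mulA sf_mulC sf_mul1 sf_mulDl sf_one_neq0.

Definition sf_scale (k : R) F := SuperFun (k *: sf0 F) (k *: sf1 F).

Fact sf_scaleA k l F : sf_scale k (sf_scale l F) = sf_scale (k * l) F.
Proof. by apply: superfunP; rewrite /= scalerA. Qed.
Fact sf_scale1 : left_id 1 sf_scale.
Proof. by move=> F; apply: superfunP; rewrite /= scale1r. Qed.
Fact sf_scaleDr : right_distributive sf_scale +%R.
Proof. by move=> k F G; apply: superfunP; rewrite /= scalerDr. Qed.
Fact sf_scaleDl F : {morph sf_scale^~ F : k l / k + l}.
Proof. by move=> k l; apply: superfunP; rewrite /= scalerDl. Qed.

HB.instance Definition _ := GRing.Zmodule_isLmodule.Build R superfun
  sf_scaleA sf_scale1 sf_scaleDr sf_scaleDl.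

Implicit Types F G H : superfun.

Lemma sf0E f g : sf0 (SuperFun f g) = f. Proof. by []. Qed.
Lemma sf1E f g : sf1 (SuperFun f g) = g. Proof. by []. Qed.
Lemma sf0D F G : sf0 (F + G) = sf0 F + sf0 G. Proof. by []. Qed.
Lemma sf1D F G : sf1 (F + G) = sf1 F + sf1 G. Proof. by []. Qed.
Lemma sf0N F : sf0 (- F) = - sf0 F. Proof. by []. Qed.
Lemma sf1N F : sf1 (- F) = - sf1 F. Proof. by []. Qed.
Lemma sf00 : sf0 0 = 0. Proof. by []. Qed.
Lemma sf10 : sf1 0 = 0. Proof. by []. Qed.
Lemma sf01 : sf0 1 = 1. Proof. by []. Qed.
Lemma sf11 : sf1 1 = 0. Proof. by []. Qed.
Lemma sf0M F G : sf0 (F * G) = sf0 F * sf0 G. Proof. by []. Qed.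
Lemma sf1M F G : sf1 (F * G) = sf0 F * sf1 G + sf1 F * sf0 G. Proof. by []. Qed.
Lemma sf0Z k F : sf0 (k *: F) = k *: sf0 F. Proof. by []. Qed.
Lemma sf1Z k F : sf1 (k *: F) = k *: sf1 F. Proof. by []. Qed.

Definition sfE := (sf0E, sf1E, sf0D, sf1D, sf0N, sf1N, sf00, sf10, sf01, sf11, sf0M, sf1M,
  sf0Z, sf1Z).

(* Parities are booleans, [true] being odd; [sfpart p F] is the homogeneous
   component of F of parity p. *)
Definition sfpart (p : bool) F :=
  if p then SuperFun 0 (sf1 F) else SuperFun (sf0 F) 0.

Definition sx := SuperFun (cX R) 0.
Definition stheta := SuperFun 0 1.

Definition dx F := SuperFun (cderiv (sf0 F)) (cderiv (sf1 F)).
Definition dtheta F := SuperFun (sf1 F) 0.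
Definition eta F := dtheta F + stheta * dx F.
Definition etabar F := dtheta F - stheta * dx F.

Definition contact_field H F := H * dx F + 2^-1 *: (eta H * etabar F).

Definition contact_bracket F G :=
  F * dx G - dx F * G + 2^-1 *: (eta F * etabar G).

Definition Lie_density (lambda : R) H F :=
  contact_field H F + lambda *: (dx H * F).

End SuperFunctions.

Section Osp.
Variable R : realType.
Local Notation superfun := (superfun R).
Implicit Types H F G : superfun.

(* The contact field X_H is represented by its generating function H. *)
Definition in_osp12 H := exists a b c d e : R,
  H = a *: (1 : superfun) + b *: sx R + c *: sx R ^+ 2 + d *: stheta R
      + e *: (sx R * stheta R).

Definition osp12_pred : {pred superfun} := fun H => `[< in_osp12 H >].

Lemma osp12_submod : GRing.submod_closed osp12_pred.
Proof.
split.
  apply/asboolP; exists 0, 0, 0, 0, 0.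
  by rewrite !scale0r !addr0.
move=> k F G /asboolP[a [b [c [d [e ->]]]]] /asboolP[a' [b' [c' [d' [e' ->]]]]].
apply/asboolP; exists (k * a + a'), (k * b + b'), (k * c + c'),
  (k * d + d'), (k * e + e').
by apply: superfunP; apply: cfunP => t; rewrite /sx /stheta !(sfE, expr2) !cE; ring.
Qed.

HB.instance Definition _ :=
  GRing.isSubmodClosed.Build R superfun osp12_pred osp12_submod.

Record osp12 := MkOsp12 { ospfun :> superfun; _ : ospfun \in osp12_pred }.

HB.instance Definition _ := [isSub for ospfun].
HB.instance Definition _ := [Choice of osp12 by <:].
HB.instance Definition _ := [SubChoice_isSubLmodule of osp12 by <:].

Lemma in_osp12_val (g : osp12) : in_osp12 g.
Proof. by case: g => g /= /asboolP. Qed.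

Lemma osp12_bracket_closed (g h : osp12) :
  contact_bracket g h \in osp12_pred.
Proof.
have [a [b [c [d [e ->]]]]] := in_osp12_val g.
have [a' [b' [c' [d' [e' ->]]]]] := in_osp12_val h.
apply/asboolP.
exists (a * b' - b * a' + d * d' / 2), (2 * (a * c' - c * a') + (d * e' + e * d') / 2),
  (b * c' - c * b' + e * e' / 2),
  (a * e' - b * d' / 2 + d * b' / 2 - e * a'),
  (b * e' / 2 - c * d' + d * c' - e * b' / 2).
apply: superfunP; rewrite /contact_bracket /eta /etabar /dtheta /dx;
  rewrite /sx /stheta !(sfE, expr2);
  rewrite !(cderivD, cderivZ, cderivM, cderivX, cderiv1, cderiv0);
  by apply: cfunP => t; rewrite !cE; field.
Qed.

Definition osp12_bracket (g h : osp12) : osp12 :=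
  MkOsp12 (osp12_bracket_closed g h).

Lemma osp12_part_closed p (g : osp12) : sfpart p g \in osp12_pred.
Proof.
have [a [b [c [d [e ->]]]]] := in_osp12_val g.
case: p; apply/asboolP; [exists 0, 0, 0, d, e|exists a, b, c, 0, 0];
  by apply: superfunP; apply: cfunP => t; rewrite /sfpart /sx /stheta !(sfE, expr2) !cE; ring.
Qed.

Definition osp12_part p (g : osp12) : osp12 := MkOsp12 (osp12_part_closed p g).

Definition sl2 : set osp12 := [set g | exists a b c : R,
  ospfun g = a *: (1 : superfun) + b *: sx R + c *: sx R ^+ 2].

End Osp.
Arguments sl2 : clear implicits.

Section BidifferentialOperators.
Variable R : realType.
Local Notation superfun := (superfun R).
Local Notation bimap := (superfun -> superfun -> superfun).
Implicit Types (F G H C : superfun) (A B : bimap).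

Definition sder i (a : bool) F := iter i (@dx R) (if a then dtheta F else F).

(* The usual sign in front of the derivatives of G can be absorbed in the
   coefficients, as (-1)^|F| F = F - 2 theta dtheta F. *)
Definition is_bidiff A := exists N (c : nat -> bool -> nat -> bool -> superfun),
  forall F G, A F G =
    \sum_(i < N) \sum_(a : bool) \sum_(j < N) \sum_(b : bool)
      c i a j b * sder i a F * sder j b G.

Lemma dxD F G : dx (F + G) = dx F + dx G.
Proof. by apply: superfunP; rewrite /dx !sfE cderivD. Qed.

Lemma dxM F G : dx (F * G) = dx F * G + F * dx G.
Proof.
by apply: superfunP; rewrite /dx !sfE ?cderivD !cderivM; ring.
Qed.

Lemma dxZ k F : dx (k *: F) = k *: dx F.
Proof. by apply: superfunP; rewrite /dx !sfE cderivZ. Qed.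

Lemma dx0 : dx (0 : superfun) = 0.
Proof. by apply: superfunP; rewrite /dx !sfE cderiv0. Qed.

Lemma dthetaD F G : dtheta (F + G) = dtheta F + dtheta G.
Proof. by apply: superfunP; rewrite /dtheta !sfE ?addr0. Qed.

Lemma dthetaZ k F : dtheta (k *: F) = k *: dtheta F.
Proof. by apply: superfunP; rewrite /dtheta !sfE ?scaler0. Qed.

Lemma dtheta0 : dtheta (0 : superfun) = 0.
Proof. by apply: superfunP; rewrite /dtheta !sfE. Qed.

Lemma dthetaM F G : dtheta (F * G) =
  dtheta F * G + F * dtheta G + (- (stheta R + stheta R)) * dtheta F * dtheta G.
Proof.
by apply: superfunP; rewrite /dtheta /stheta !sfE; ring.
Qed.

Lemma dtheta_dx F : dtheta (dx F) = dx (dtheta F).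
Proof. by apply: superfunP; rewrite /dx /dtheta !sfE ?cderiv0. Qed.

Lemma dtheta_dtheta F : dtheta (dtheta F) = 0.
Proof. by apply: superfunP; rewrite /dtheta !sfE. Qed.

Lemma sderD i a F G : sder i a (F + G) = sder i a F + sder i a G.
Proof.
rewrite /sder; have -> : (if a then dtheta (F + G) else F + G) =
    (if a then dtheta F else F) + (if a then dtheta G else G).
  by case: a; rewrite ?dthetaD.
by elim: i => //= i ->; rewrite dxD.
Qed.

Lemma sder0 i a : sder i a 0 = 0.
Proof.
rewrite /sder; have -> : (if a then dtheta 0 else 0) = 0 :> superfun.
  by case: a; rewrite ?dtheta0.
by elim: i => //= i ->; rewrite dx0.
Qed.

Lemma dx_sder i a F : dx (sder i a F) = sder i.+1 a F. Proof. by []. Qed.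

Lemma sder_dx i a F : sder i a (dx F) = sder i.+1 a F.
Proof. by rewrite /sder iterSr; case: a; rewrite ?dtheta_dx. Qed.

Lemma dtheta_sder i a F : dtheta (sder i a F) = if a then 0 else sder i true F.
Proof.
elim: i => [|i IH]; first by case: a => //=; rewrite dtheta_dtheta.
by rewrite -dx_sder dtheta_dx IH; case: a IH => //= _; rewrite dx0.
Qed.

Lemma sder_dtheta i a F : sder i a (dtheta F) = if a then 0 else sder i true F.
Proof. by case: a => //; rewrite /sder dtheta_dtheta; exact: (sder0 i false). Qed.

Lemma is_bidiff0 : is_bidiff (fun _ _ => 0).
Proof. by exists 0%N, (fun _ _ _ _ => 0) => F G; rewrite big_ord0. Qed.

Lemma is_bidiff_widen A N (c : nat -> bool -> nat -> bool -> superfun) M : (N <= M)%N ->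
  (forall F G, A F G =
    \sum_(i < N) \sum_(a : bool) \sum_(j < N) \sum_(b : bool)
      c i a j b * sder i a F * sder j b G) ->
  forall F G, A F G =
    \sum_(i < M) \sum_(a : bool) \sum_(j < M) \sum_(b : bool)
      (if (i < N)%N && (j < N)%N then c i a j b else 0)
        * sder i a F * sder j b G.
Proof.
move=> NM HA F G; rewrite HA.
rewrite (big_ord_widen M (fun i => \sum_(a : bool) \sum_(j < N) \sum_(b : bool)
      c i a j b * sder i a F * sder j b G) NM) [LHS]big_mkcond /=.
apply: eq_bigr => i _; case: ltnP => iN; last first.
  by rewrite big1 // => a _; rewrite big1 // => j _; rewrite big1 // => b _;
     rewrite !mul0r.
apply: eq_bigr => a _.
rewrite (big_ord_widen M (fun j => \sum_(b : bool)
      c i a j b * sder i a F * sder j b G) NM) [LHS]big_mkcond /=.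
apply: eq_bigr => j _; case: ltnP => jN //.
by rewrite big1 // => b _; rewrite !mul0r.
Qed.

Lemma is_bidiffD A B : is_bidiff A -> is_bidiff B ->
  is_bidiff (fun F G => A F G + B F G).
Proof.
move=> [N [c cA]] [M [d dB]].
have {}cA := is_bidiff_widen (leq_maxl N M) cA.
have {}dB := is_bidiff_widen (leq_maxr N M) dB.
exists (maxn N M), (fun i a j b =>
  (if (i < N)%N && (j < N)%N then c i a j b else 0) +
  (if (i < M)%N && (j < M)%N then d i a j b else 0)) => F G.
rewrite cA dB; do 4![rewrite -big_split /=; apply: eq_bigr => ? _].
by rewrite !mulrDl.
Qed.

Lemma is_bidiffM C A : is_bidiff A -> is_bidiff (fun F G => C * A F G).
Proof.
move=> [N [c cA]]; exists N, (fun i a j b => C * c i a j b) => F G.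
by rewrite cA; do 4![rewrite mulr_sumr; apply: eq_bigr => ? _]; rewrite !mulrA.
Qed.

Lemma is_bidiff_mono C i a j b :
  is_bidiff (fun F G => C * sder i a F * sder j b G).
Proof.
exists (maxn i j).+1, (fun i' a' j' b' =>
  if [&& i' == i, a' == a, j' == j & b' == b] then C else 0) => F G.
have iM : (i < (maxn i j).+1)%N by rewrite ltnS leq_maxl.
have jM : (j < (maxn i j).+1)%N by rewrite ltnS leq_maxr.
rewrite (bigD1 (Ordinal iM)) //= [X in _ + X]big1 ?addr0; last first.
  move=> k /eqP ki; rewrite big1 // => a' _; rewrite big1 // => j' _.
  rewrite big1 // => b' _; case: (nat_of_ord k =P i) => [ik|_].
    by case: ki; apply: val_inj.
  by rewrite !mul0r.
rewrite (bigD1 a) //= [X in _ + X]big1 ?addr0; last first.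
  move=> k /negbTE ka; rewrite big1 // => j' _.
  by rewrite big1 // => b' _; rewrite ka andbF !mul0r.
rewrite (bigD1 (Ordinal jM)) //= [X in _ + X]big1 ?addr0; last first.
  move=> k /eqP kj; rewrite big1 // => b' _; case: (nat_of_ord k =P j) => [jk|_].
    by case: kj; apply: val_inj.
  by rewrite !andbF !mul0r.
rewrite (bigD1 b) //= [X in _ + X]big1 ?addr0; last first.
  by move=> k /negbTE kb; rewrite kb !andbF !mul0r.
by rewrite !eqxx.
Qed.

Lemma is_bidiff_ext A B : (forall F G, A F G = B F G) ->
  is_bidiff A -> is_bidiff B.
Proof. by move=> AB [N [c cA]]; exists N, c => F G; rewrite -AB. Qed.

Lemma is_bidiff_sum (I : Type) (r : seq I) (P : pred I) (A : I -> bimap) :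
  (forall i, is_bidiff (A i)) ->
  is_bidiff (fun F G => \sum_(i <- r | P i) A i F G).
Proof.
move=> bA; elim: r => [|i r IH].
  by apply: is_bidiff_ext is_bidiff0 => F G; rewrite big_nil.
case Pi : (P i).
  by apply: is_bidiff_ext (is_bidiffD (bA i) IH) => F G; rewrite big_cons Pi.
by apply: is_bidiff_ext IH => F G; rewrite big_cons Pi.
Qed.

Lemma is_bidiff_ind (T : bimap -> bimap) :
  (forall A B, (forall F G, A F G = B F G) ->
     forall F G, T A F G = T B F G) ->
  (forall F G, T (fun _ _ => 0) F G = 0) ->
  (forall A B F G,
     T (fun F G => A F G + B F G) F G = T A F G + T B F G) ->
  (forall C i a j b, is_bidiff (T (fun F G => C * sder i a F * sder j b G))) ->
  forall A, is_bidiff A -> is_bidiff (T A).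
Proof.
move=> Text T0 TD Tm A [N [c cA]].
have Tsum (I : Type) (r : seq I) (P : pred I) (E : I -> bimap) F G :
    T (fun F G => \sum_(i <- r | P i) E i F G) F G =
    \sum_(i <- r | P i) T (E i) F G.
  elim: r => [|i r IH].
    by rewrite big_nil -[RHS](T0 F G); apply: Text => ? ?; rewrite big_nil.
  rewrite big_cons; case Pi : (P i).
    by rewrite -IH -TD; apply: Text => ? ?; rewrite big_cons Pi.
  by rewrite -IH; apply: Text => ? ?; rewrite big_cons Pi.
apply: is_bidiff_ext (fun F G => esym (Text _ _ cA F G)) _.
have S (n : finType) (E : n -> bimap) : (forall i, is_bidiff (T (E i))) ->
    is_bidiff (T (fun F G => \sum_i E i F G)).
  move=> bE; apply: is_bidiff_ext (is_bidiff_sum (index_enum n) xpredT bE).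
  by move=> F G; rewrite Tsum.
by apply: (S) => i; apply: (S) => a; apply: (S) => j; apply: (S) => b; exact: Tm.
Qed.

Lemma is_bidiff_swap A : is_bidiff A -> is_bidiff (fun F G => A G F).
Proof.
move: A; apply: (is_bidiff_ind (T := fun A F G => A G F)) => // C i a j b.
by apply: is_bidiff_ext (is_bidiff_mono C j b i a) => F G; rewrite mulrAC.
Qed.

Definition first_order C1 C2 C3 F := C1 * dx F + C2 * dtheta F + C3 * F.

Lemma is_bidiff_post C1 C2 C3 A : is_bidiff A ->
  is_bidiff (fun F G => first_order C1 C2 C3 (A F G)).
Proof.
have bdx : forall A, is_bidiff A -> is_bidiff (fun F G => dx (A F G)).
  apply: (is_bidiff_ind (T := fun A F G => dx (A F G))).
  - by move=> B D BD F G; rewrite BD.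
  - by move=> F G; rewrite dx0.
  - by move=> B D F G; rewrite dxD.
  move=> C i a j b; apply: is_bidiff_ext (is_bidiffD (is_bidiffD
    (is_bidiff_mono (dx C) i a j b) (is_bidiff_mono C i.+1 a j b))
    (is_bidiff_mono C i a j.+1 b)) => F G.
  by rewrite !dxM !dx_sder mulrDl.
have bdt : forall A, is_bidiff A -> is_bidiff (fun F G => dtheta (A F G)).
  apply: (is_bidiff_ind (T := fun A F G => dtheta (A F G))).
  - by move=> B D BD F G; rewrite BD.
  - by move=> F G; rewrite dtheta0.
  - by move=> B D F G; rewrite dthetaD.
  move=> C i a j b.
  have m0 (D : superfun) (a' b' : bool) : is_bidiff (fun F G => D *
      (if a' then 0 else sder i true F) * (if b' then 0 else sder j true G)).
    case: a' b' => [] [];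
      [| | |exact: is_bidiff_mono];
      by apply: is_bidiff_ext is_bidiff0 => F G; rewrite ?(mulr0, mul0r).
  have m1 (D : superfun) (a' : bool) : is_bidiff (fun F G => D *
      (if a' then 0 else sder i true F) * sder j b G).
    case: a'; last exact: is_bidiff_mono.
    by apply: is_bidiff_ext is_bidiff0 => F G; rewrite ?(mulr0, mul0r).
  have m2 (D : superfun) (b' : bool) : is_bidiff (fun F G => D *
      sder i a F * (if b' then 0 else sder j true G)).
    case: b'; last exact: is_bidiff_mono.
    by apply: is_bidiff_ext is_bidiff0 => F G; rewrite ?(mulr0, mul0r).
  pose k := - (stheta R + stheta R).
  apply: is_bidiff_ext (is_bidiffD (is_bidiffD
    (is_bidiffD (is_bidiff_mono (dtheta C) i a j b) (m1 (C + k * dtheta C) a))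
    (m2 (C + k * dtheta C) b))
    (m0 (k * C + k * k * dtheta C) a b)) => F G.
  rewrite !dthetaM !dtheta_sder -/k.
  ring.
move=> bA; apply: is_bidiffD; first apply: is_bidiffD.
- exact: is_bidiffM (bdx _ bA).
- exact: is_bidiffM (bdt _ bA).
- exact: is_bidiffM.
Qed.

Lemma is_bidiff_prel C1 C2 C3 A : is_bidiff A ->
  is_bidiff (fun F G => A (first_order C1 C2 C3 F) G).
Proof.
pose pre (u : superfun -> superfun) := forall C i j b,
  is_bidiff (fun F G => C * iter i (@dx R) (u F) * sder j b G).
have preS a i : pre (sder i a).
  move=> C k j b; apply: is_bidiff_ext (is_bidiff_mono C (k + i) a j b) => F G.
  by rewrite /sder iterD.
have preD u v : pre u -> pre v -> pre (fun F => u F + v F).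
  move=> pu pv C i j b; apply: is_bidiff_ext
    (is_bidiffD (pu C i j b) (pv C i j b)) => F G.
  by rewrite [iter i _ (_ + _)](sderD i false) mulrDr mulrDl.
have predx u : pre u -> pre (fun F => dx (u F)).
  by move=> pu C i j b; apply: is_bidiff_ext (pu C i.+1 j b) => F G; rewrite iterSr.
have preM D u : pre u -> pre (fun F => D * u F).
  move=> + C i; elim: i C D u => [|i IH] C D u pu j b.
    apply: is_bidiff_ext (is_bidiffM D (pu C 0%N j b)) => F G /=; ring.
  apply: is_bidiff_ext (is_bidiffD (IH C (dx D) u pu j b)
     (IH C D _ (predx u pu) j b)) => F G.
  by rewrite iterSr dxM [iter i _ (_ + _)](sderD i false) mulrDr mulrDl.
have preMS D a i : pre (fun F => D * sder i a F) := preM D _ (preS a i).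
move: A; apply: (is_bidiff_ind (T := fun A F G =>
  A (first_order C1 C2 C3 F) G)) => //.
move=> C i [] j b.
  pose k := - (stheta R + stheta R).
  have pz : pre (fun _ => 0).
    move=> D l m s; apply: is_bidiff_ext is_bidiff0 => F G.
    by rewrite [iter l _ 0](sder0 l false) mulr0 mul0r.
  have P : pre (fun F => (dtheta C1) * sder 1 false F
     + (C1 + k * dtheta C1) * sder 1 true F + (dtheta C2) * sder 0 true F
     + (dtheta C3) * sder 0 false F + (C3 + k * dtheta C3) * sder 0 true F).
    exact: (preD _ _ (preD _ _ (preD _ _ (preD _ _ (preMS _ _ _) (preMS _ _ _))
      (preMS _ _ _)) (preMS _ _ _)) (preMS _ _ _)).
  apply: is_bidiff_ext (P C i j b) => F G; congr (_ * iter _ _ _ * _).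
  rewrite /first_order /sder /= !dthetaD !dthetaM -/k dtheta_dx dtheta_dtheta.
  ring.
have P : pre (fun F => C1 * sder 1 false F + C2 * sder 0 true F
   + C3 * sder 0 false F).
  exact: (preD _ _ (preD _ _ (preMS _ _ _) (preMS _ _ _)) (preMS _ _ _)).
by apply: is_bidiff_ext (P C i j b) => F G.
Qed.

Lemma is_bidiff_prer C1 C2 C3 A : is_bidiff A ->
  is_bidiff (fun F G => A F (first_order C1 C2 C3 G)).
Proof.
by move=> bA; exact: is_bidiff_swap (is_bidiff_prel C1 C2 C3 (is_bidiff_swap bA)).
Qed.

Lemma sf_scaleM (k : R) F : k *: F = (k *: (1 : superfun)) * F.
Proof.
by apply: superfunP; apply: cfunP => t; rewrite !sfE !cE; ring.
Qed.

Lemma Lie_density_first_order lambda H F : Lie_density lambda H F =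
  first_order (H - (2^-1 *: (1 : superfun)) * eta H * stheta R) ((2^-1 *: (1 : superfun)) * eta H)
    ((lambda *: (1 : superfun)) * dx H) F.
Proof.
rewrite /Lie_density /contact_field /first_order /etabar.
by rewrite (sf_scaleM 2^-1 (_ * _)) (sf_scaleM lambda (_ * _)); ring.
Qed.

Lemma sfpart_first_order p F : sfpart p F =
  first_order 0 (if p then stheta R else - stheta R) (if p then 0 else 1) F.
Proof.
by case: p; apply: superfunP; rewrite /sfpart /first_order /stheta /dtheta !sfE; ring.
Qed.

Lemma is_bidiffZ k A : is_bidiff A -> is_bidiff (fun F G => k *: A F G).
Proof.
by move=> bA; apply: is_bidiff_ext (is_bidiffM (k *: (1 : superfun)) bA) => F G;
  rewrite [RHS]sf_scaleM.
Qed.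

Definition bidiff_pred : {pred bimap} := fun A => `[< is_bidiff A >].

Lemma bidiff_submod : GRing.submod_closed bidiff_pred.
Proof.
split; first by apply/asboolP; exact: is_bidiff0.
move=> k A B /asboolP bA /asboolP bB; apply/asboolP.
exact: is_bidiffD (is_bidiffZ k bA) bB.
Qed.

HB.instance Definition _ :=
  GRing.isSubmodClosed.Build R bimap bidiff_pred bidiff_submod.

Record bidiffop := MkBidiffop { bdfun :> bimap; _ : bdfun \in bidiff_pred }.

HB.instance Definition _ := [isSub for bdfun].
HB.instance Definition _ := [Choice of bidiffop by <:].
HB.instance Definition _ := [SubChoice_isSubLmodule of bidiffop by <:].

Lemma bidiffopP (A B : bidiffop) : (forall F G, A F G = B F G) -> A = B.
Proof. by move=> AB; apply/val_inj/funext => F; apply/funext. Qed.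

Lemma bidiffop_bidiff (A : bidiffop) : is_bidiff A.
Proof. by case: A => A /= /asboolP. Qed.

(* Component of parity q: A is even (resp. odd) when A F G has parity
   |F| + |G| (resp. |F| + |G| + 1) for all homogeneous F and G. *)
Definition bimap_part q A : bimap := fun F G =>
  \sum_(p : bool) \sum_(s : bool)
    sfpart (q (+) p (+) s) (A (sfpart p F) (sfpart s G)).

(* Composition of A with the action of X_H on the tensor product. *)
Definition Lie_tensor lambda nu H A : bimap := fun F G =>
  \sum_(p : bool) \sum_(s : bool)
    (A (Lie_density lambda (sfpart p H) (sfpart s F)) G
     + (-1) ^+ (p && s) *: A (sfpart s F) (Lie_density nu (sfpart p H) G)).

(* The sign rules are stated on homogeneous elements; here and below, they are
   extended by multilinearity, summing over homogeneous components. *)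
Definition Lie_bimap lambda nu mu H A : bimap := fun F G =>
  \sum_(p : bool) \sum_(q : bool)
    (Lie_density mu (sfpart p H) (bimap_part q A F G)
     - (-1) ^+ (p && q) *: Lie_tensor lambda nu (sfpart p H) (bimap_part q A) F G).

Lemma is_bidiff_part q A : is_bidiff A -> is_bidiff (bimap_part q A).
Proof.
move=> bA; do 2!apply: is_bidiff_sum => ?.
apply: is_bidiff_ext (is_bidiff_post _ _ _ (is_bidiff_prel _ _ _
  (is_bidiff_prer _ _ _ bA))) => F G.
by rewrite !sfpart_first_order.
Qed.

Lemma is_bidiff_tensor lambda nu H A : is_bidiff A ->
  is_bidiff (Lie_tensor lambda nu H A).
Proof.
move=> bA; do 2!apply: is_bidiff_sum => ?; apply: is_bidiffD.
  apply: is_bidiff_ext (is_bidiff_prel _ _ _ (is_bidiff_prel _ _ _ bA)) => F G.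
  by rewrite Lie_density_first_order ?(sfpart_first_order _ F).
apply: is_bidiffZ.
apply: is_bidiff_ext (is_bidiff_prel _ _ _ (is_bidiff_prer _ _ _ bA)) => F G.
by rewrite Lie_density_first_order ?(sfpart_first_order _ F).
Qed.

Lemma is_bidiff_Lie lambda nu mu H A : is_bidiff A ->
  is_bidiff (Lie_bimap lambda nu mu H A).
Proof.
move=> bA; do 2!apply: is_bidiff_sum => ?; apply: is_bidiffD.
  apply: is_bidiff_ext (is_bidiff_post _ _ _ (is_bidiff_part _ bA)) => F G.
  by rewrite Lie_density_first_order.
apply: is_bidiff_ext (is_bidiffZ (-1) (is_bidiffZ _ (is_bidiff_tensor _ _ _
  (is_bidiff_part _ bA)))) => F G.
by rewrite scaleN1r.
Qed.

Definition bidiff_part q (A : bidiffop) : bidiffop :=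
  MkBidiffop (introT (asboolP _) (is_bidiff_part q (bidiffop_bidiff A))).

Definition bidiff_act lambda nu mu (g : osp12 R) (A : bidiffop) : bidiffop :=
  MkBidiffop (introT (asboolP _)
    (is_bidiff_Lie lambda nu mu g (bidiffop_bidiff A))).

End BidifferentialOperators.

Section Cohomology.
Variable R : realType.
Variables lambda nu mu : R.
Local Notation superfun := (superfun R).
Local Notation osp12 := (osp12 R).
Local Notation bidiffop := (bidiffop R).
Local Notation act := (bidiff_act lambda nu mu).
Implicit Types (g h : osp12) (v w : bidiffop) (Y : osp12 -> bidiffop)
  (k : set osp12).

Lemma sfpartB p (F G : superfun) : sfpart p (F - G) = sfpart p F - sfpart p G.
Proof. by case: p; apply: superfunP; rewrite /sfpart !sfE ?subrr. Qed.

Lemma Lie_densityB (a : R) (H F G : superfun) :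
  Lie_density a H (F - G) = Lie_density a H F - Lie_density a H G.
Proof.
rewrite !Lie_density_first_order /first_order -(scaleN1r G).
by rewrite dxD dthetaD dxZ dthetaZ !scaleN1r; ring.
Qed.

Lemma bidiff_partB q v w : bidiff_part q (v - w) = bidiff_part q v - bidiff_part q w.
Proof.
apply: bidiffopP => F G; rewrite /= /bimap_part -[RHS]sumrB.
apply: eq_bigr => p _; rewrite -[RHS]sumrB; apply: eq_bigr => s _.
exact: sfpartB.
Qed.

Lemma bidiff_actB g v w : act g (v - w) = act g v - act g w.
Proof.
apply: bidiffopP => F G.
change (Lie_bimap lambda nu mu g (v - w : bidiffop) F G =
  Lie_bimap lambda nu mu g v F G - Lie_bimap lambda nu mu g w F G).
rewrite /Lie_bimap -[RHS]sumrB; apply: eq_bigr => p _.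
rewrite -[RHS]sumrB; apply: eq_bigr => q _.
have E (F' G' : superfun) : bimap_part q (v - w : bidiffop) F' G' =
    bimap_part q v F' G' - bimap_part q w F' G'.
  exact: (congr1 (fun A : bidiffop => A F' G') (bidiff_partB q v w)).
have -> : Lie_tensor lambda nu (sfpart p g) (bimap_part q (v - w : bidiffop)) F G
  = Lie_tensor lambda nu (sfpart p g) (bimap_part q v) F G
    - Lie_tensor lambda nu (sfpart p g) (bimap_part q w) F G.
  rewrite /Lie_tensor -[RHS]sumrB; apply: eq_bigr => p' _.
  rewrite -[RHS]sumrB; apply: eq_bigr => s _.
  by rewrite !E scalerBr opprD addrACA.
by rewrite E Lie_densityB scalerBr !opprD addrACA.
Qed.

Definition cochain_part r Y : osp12 -> bidiffop := fun g =>
  \sum_(p : bool) bidiff_part (r (+) p) (Y (osp12_part p g)).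

Definition delta0 v : osp12 -> bidiffop := fun g =>
  \sum_(p : bool) \sum_(r : bool)
    (-1) ^+ (p && r) *: act (osp12_part p g) (bidiff_part r v).

Definition delta1 Y : osp12 -> osp12 -> bidiffop := fun g h =>
  \sum_(p : bool) \sum_(q : bool) \sum_(r : bool)
    ((-1) ^+ (p && r)
       *: act (osp12_part p g) (cochain_part r Y (osp12_part q h))
     - (-1) ^+ (q && (p (+) r))
       *: act (osp12_part q h) (cochain_part r Y (osp12_part p g)))
  - Y (osp12_bracket g h).

(* Y g F G is a trilinear differential operator in the generating function of
   g and in F and G. *)
Definition is_diff_cochain Y := exists N
    (c : nat -> bool -> nat -> bool -> nat -> bool -> superfun),
  forall g (F G : superfun), Y g F G =
    \sum_(l < N) \sum_(d : bool) \sum_(i < N) \sum_(a : bool)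
    \sum_(j < N) \sum_(b : bool)
      c l d i a j b * sder l d g * sder i a F * sder j b G.

(* Below, k is the subalgebra to which cohomology is relative; absolute
   cohomology is k = [set 0]. *)
Definition is_cochain0 k v := forall g, k g -> act g v = 0.

(* A linear map on osp12 / k is a linear map on osp12 vanishing on k; the last
   condition is equivariance under k. *)
Definition is_cochain1 k Y :=
  [/\ linear Y, is_diff_cochain Y, (forall h, k h -> Y h = 0) &
      forall h g, k h ->
        \sum_(p : bool) \sum_(r : bool)
          (-1) ^+ (p && r) *: act (osp12_part p h) (cochain_part r Y g)
        = Y (osp12_bracket h g)].

Definition is_cocycle1 k Y := is_cochain1 k Y /\ forall g h, delta1 Y g h = 0.

Definition is_coboundary1 k Y := exists2 v, is_cochain0 k v & Y = delta0 v.

(* The restriction of Y to k is a coboundary over k. *)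
Definition is_coboundary1_on k Y :=
  exists v, forall g, k g -> Y g = delta0 v g.

Lemma cochain_partB r Y Y' g :
  cochain_part r (Y - Y') g = cochain_part r Y g - cochain_part r Y' g.
Proof. by rewrite /cochain_part -sumrB; apply: eq_bigr => p _; exact: bidiff_partB. Qed.

Lemma delta0B v w g : delta0 (v - w) g = delta0 v g - delta0 w g.
Proof.
rewrite /delta0 -sumrB; apply: eq_bigr => p _; rewrite -sumrB.
by apply: eq_bigr => r _; rewrite bidiff_partB bidiff_actB scalerBr.
Qed.

Lemma delta1B Y Y' g h : delta1 (Y - Y') g h = delta1 Y g h - delta1 Y' g h.
Proof.
have D (a b c d : bidiffop) : a - b - (c - d) = a - c - (b - d).
  by rewrite !opprD !opprK addrACA.
rewrite /delta1 [RHS]D -sumrB; congr (_ - _).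
apply: eq_bigr => p _; rewrite -sumrB; apply: eq_bigr => q _; rewrite -sumrB.
apply: eq_bigr => r _; rewrite !cochain_partB !bidiff_actB !scalerBr.
exact: D.
Qed.

Lemma is_diff_cochain_widen Y N
    (c : nat -> bool -> nat -> bool -> nat -> bool -> superfun) M :
  (N <= M)%N ->
  (forall g F G, Y g F G =
    \sum_(l < N) \sum_(d : bool) \sum_(i < N) \sum_(a : bool)
    \sum_(j < N) \sum_(b : bool)
      c l d i a j b * sder l d g * sder i a F * sder j b G) ->
  forall g F G, Y g F G =
    \sum_(l < M) \sum_(d : bool) \sum_(i < M) \sum_(a : bool)
    \sum_(j < M) \sum_(b : bool)
      (if [&& (l < N)%N, (i < N)%N & (j < N)%N] then c l d i a j b else 0)
        * sder l d g * sder i a F * sder j b G.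
Proof.
have W (E : nat -> superfun) : (N <= M)%N ->
    \sum_(i < N) E i = \sum_(i < M) if (i < N)%N then E i else 0.
  by move=> NM; rewrite (big_ord_widen M E NM) big_mkcond.
move=> NM HY g F G; rewrite HY.
rewrite (W (fun l => \sum_(d : bool) \sum_(i < N) \sum_(a : bool)
    \sum_(j < N) \sum_(b : bool)
      c l d i a j b * sder l d g * sder i a F * sder j b G)) //.
apply: eq_bigr => l _; case: ltnP => lN; last first.
  by rewrite big1 // => d _; rewrite big1 // => i _; rewrite big1 // => a _;
     rewrite big1 // => j _; rewrite big1 // => b _; rewrite !mul0r.
apply: eq_bigr => d _.
rewrite (W (fun i => \sum_(a : bool) \sum_(j < N) \sum_(b : bool)
      c l d i a j b * sder l d g * sder i a F * sder j b G)) //.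
apply: eq_bigr => i _; case: ltnP => iN; last first.
  by rewrite big1 // => a _; rewrite big1 // => j _; rewrite big1 // => b _;
     rewrite !mul0r.
apply: eq_bigr => a _.
rewrite (W (fun j => \sum_(b : bool)
      c l d i a j b * sder l d g * sder i a F * sder j b G)) //.
apply: eq_bigr => j _; case: ltnP => jN //.
by rewrite big1 // => b _; rewrite !mul0r.
Qed.

Lemma is_diff_cochainB Y Y' :
  is_diff_cochain Y -> is_diff_cochain Y' -> is_diff_cochain (Y - Y').
Proof.
move=> [N [c cY]] [M [d dY]].
have {}cY := is_diff_cochain_widen (leq_maxl N M) cY.
have {}dY := is_diff_cochain_widen (leq_maxr N M) dY.
exists (maxn N M), (fun l e i a j b =>
  (if [&& (l < N)%N, (i < N)%N & (j < N)%N] then c l e i a j b else 0) -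
  (if [&& (l < M)%N, (i < M)%N & (j < M)%N] then d l e i a j b else 0)).
move=> g F G; rewrite -[LHS]/(Y g F G - Y' g F G).
rewrite cY dY; do 6![rewrite -sumrB /=; apply: eq_bigr => ? _].
by rewrite !mulrBl.
Qed.

Lemma is_diff_cochain0 : is_diff_cochain (fun _ => 0).
Proof. by exists 0%N, (fun _ _ _ _ _ _ => 0) => g F G; rewrite big_ord0. Qed.

Lemma bidiff_act0 g : act g 0 = 0.
Proof. have := bidiff_actB g 0 0; by rewrite !subrr. Qed.

Lemma bidiff_part0 q : bidiff_part q (0 : bidiffop) = 0.
Proof. have := bidiff_partB q 0 0; by rewrite !subrr. Qed.

Lemma cochain_part0 r g : cochain_part r 0 g = 0.
Proof. have := cochain_partB r 0 0 g; by rewrite !subrr. Qed.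

Definition cocycle1_pred k : {pred osp12 -> bidiffop} :=
  fun Y => `[< is_cocycle1 k Y >].

Lemma cocycle1_zmod k : zmod_closed (cocycle1_pred k).
Proof.
split.
  apply/asboolP; split; last first.
    by move=> g h; have := delta1B 0 0 g h; rewrite !subrr.
  split => //.
  - by move=> a g h; rewrite scaler0 addr0.
  - exact: is_diff_cochain0.
  - move=> h g _; rewrite big1 // => p _; rewrite big1 // => r _.
    by rewrite cochain_part0 bidiff_act0 scaler0.
move=> Y Y' /asboolP[[lY dY kY eY] cY] /asboolP[[lY' dY' kY' eY'] cY'].
apply/asboolP; split; last first.
  by move=> g h; rewrite delta1B cY cY' subrr.
split.
- move=> a g h; change (Y (a *: g + h) - Y' (a *: g + h) =
    a *: (Y g - Y' g) + (Y h - Y' h)).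
  by rewrite lY lY' scalerBr opprD addrACA.
- exact: is_diff_cochainB.
- by move=> h kh; rewrite -[LHS]/(Y h - Y' h) kY // kY' // subrr.
- move=> h g kh.
  rewrite -[RHS]/(Y (osp12_bracket h g) - Y' (osp12_bracket h g)).
  rewrite -eY // -eY' // -sumrB; apply: eq_bigr => p _.
  rewrite -sumrB; apply: eq_bigr => r _.
  by rewrite cochain_partB bidiff_actB scalerBr.
Qed.

HB.instance Definition _ k := GRing.isZmodClosed.Build (osp12 -> bidiffop)
  (cocycle1_pred k) (cocycle1_zmod k).

Record Z1 k := MkZ1 { Z1fun :> osp12 -> bidiffop; _ : Z1fun \in cocycle1_pred k }.

HB.instance Definition _ k := [isSub for @Z1fun k].
HB.instance Definition _ k := [Choice of Z1 k by <:].
HB.instance Definition _ k := [SubChoice_isSubZmodule of Z1 k by <:].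

Definition B1 k : {pred Z1 k} := fun Y : Z1 k => `[< is_coboundary1 k Y >].

Lemma B1_zmod k : zmod_closed (@B1 k).
Proof.
split.
  apply/asboolP; exists 0; first by move=> g _; rewrite bidiff_act0.
  by apply/funext => g; have := delta0B 0 0 g; rewrite !subrr => ->.
move=> Y Y' /asboolP[v kv Yv] /asboolP[v' kv' Yv']; apply/asboolP.
exists (v - v'); first by move=> g kg; rewrite bidiff_actB kv // kv' // subrr.
apply/funext => g; rewrite delta0B -Yv -Yv'; exact: erefl.
Qed.

HB.instance Definition _ k :=
  GRing.isZmodClosed.Build (Z1 k) (@B1 k) (B1_zmod k).

Definition H1 k : zmodType := Quotient.quot (@B1 k).

End Cohomology.

(* Main.v *)
Require Import Defs.
From HB Require Import structures.
From mathcomp Require Import all_boot all_order all_algebra.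
From mathcomp Require Import all_classical all_reals all_analysis.
From mathcomp Require Import ring lra.
Import Order.TTheory GRing.Theory Num.Theory.
Local Open Scope classical_set_scope.
Local Open Scope ring_scope.

(** The vanishing holds for every osp(1|2)-module and is purely algebraic. Write
    H.v for the action of X_H on v. A cocycle Y relative to sl(2) is determined
    by A = Y(theta) and B = Y(x theta), which form an sl(2)-doublet. Up to
    signs, the cocycle condition on odd pairs says that theta.A = 0, (x theta).B
    = 0 and theta.B = - (x theta).A. The vector theta.B is therefore the
    sl(2)-invariant contraction of the doublet (A, B) with the doublet of odd
    generators; and since 2 X_theta^2 = [X_theta, X_theta] = X_1 / 2, where 1.B
    = Y([X_1, X_(x theta)]) = A, applying theta to it again gives A / 4. In the
    same way X_(x theta)^2 = X_(x^2) / 4 and x^2.A = - B, so that x theta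
    applied to the contraction - (x theta).A gives B / 4. Four times the
    contraction is thus, up to sign, an invariant vector whose coboundary is Y:
    this is [relative_cocycle_coboundary].

    The signs are tamed by using D_g v = delta0 v g in place of the action of g;
    on homogeneous g of parity p this is the action of g composed with the p-th
    power of the parity involution. With this operation the cocycle condition
    on homogeneous g, h of parities p, q becomes
      (-1)^(p q) D_g (Y h) - D_h (Y g) = Y [g, h]
    whatever the parity of Y is ([delta1_homogeneous]), and delta0 v satisfies it
    for every v because densities form a representation
    ([Lie_density_bracket], [delta0_bracket]). So bidifferential operators fit the
    algebraic statement. For the equivalence, subtract from an absolute cocycle
    the coboundary that it equals on sl(2): the difference vanishes on
    sl(2), hence is a coboundary. *)

(** * Linear maps, sums over parities *)

Lemma linear_morph {R : realType} {U V : lmodType R} (f : U -> V) : linear f ->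
  [/\ f 0 = 0, forall x y, f (x + y) = f x + f y
    & forall k x, f (k *: x) = k *: f x].
Proof.
move=> fL; have f0 : f 0 = 0.
  by have := fL (-1) 0 0; rewrite scaler0 addr0 scaleN1r addNr.
by split=> // [x y|k x]; [have := fL 1 x y|have := fL k x 0];
  rewrite ?scale1r ?f0 ?addr0.
Qed.

Lemma sum_bool_single (V : zmodType) p (f : bool -> V) :
  (forall q, (q == p) = false -> f q = 0) -> \sum_(q : bool) f q = f p.
Proof.
by case: p => f0; rewrite big_bool;
  [rewrite (f0 false) //= addr0|rewrite (f0 true) //= add0r].
Qed.

Lemma sum_addb (V : zmodType) (q : bool) (f : bool -> V) :
  \sum_(r : bool) f (r (+) q) = \sum_(r : bool) f r.
Proof. by case: q; rewrite !big_bool //= addrC. Qed.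

Lemma sub2_addACA (V : zmodType) (a b c c' e e' : V) :
  (a + b) - (c + c') - (e + e') = (a - c - e) + (b - c' - e').
Proof. by rewrite !opprD (addrACA a) (addrACA (a - c)). Qed.

Lemma cderivN {R : realType} (f : Cinf R) : cderiv (- f) = - cderiv f.
Proof. by rewrite -scaleN1r cderivZ scaleN1r. Qed.

(** Proves an equation between superfunctions built from ring operations,
    scalings and derivatives: both components are evaluated at a point, and
    the values of the functions that remain are generalized to plain scalars.
    Without this last step, comparing such values up to conversion dominates the
    cost of normalization. [lra] rather than [ring] because of the factors 1/2. *)
Ltac superfun_ring :=
  let t := fresh "t" in
  apply: superfunP; rewrite ?sfE /sf0 /sf1; apply: cfunP; intro t;
  repeat match goal with
  | |- context [cderiv (@GRing.add _ ?f ?g)] => rewrite (cderivD f g)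
  | |- context [cderiv (@GRing.opp _ ?f)] => rewrite (cderivN f)
  | |- context [cderiv (@GRing.mul _ ?f ?g)] => rewrite (cderivM f g)
  | |- context [cderiv (@GRing.scale _ _ ?k ?f)] => rewrite (cderivZ k f)
  | |- context [cderiv (@GRing.zero _)] => rewrite cderiv0
  | |- context [cderiv (@GRing.one _)] => rewrite cderiv1
  | |- context [cderiv (cX _)] => rewrite cderivX
  end;
  repeat match goal with
  | |- context [@cfun _ (@GRing.add _ ?f ?g) t] => rewrite (caddE f g)
  | |- context [@cfun _ (@GRing.opp _ ?f) t] => rewrite (coppE f)
  | |- context [@cfun _ (@GRing.mul _ ?f ?g) t] => rewrite (cmulE f g)
  | |- context [@cfun _ (@GRing.scale _ _ ?k ?f) t] => rewrite (cscaleE k f)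
  | |- context [@cfun _ (@GRing.zero _) t] => rewrite (c0E t)
  | |- context [@cfun _ (@GRing.one _) t] => rewrite (c1E t)
  end;
  repeat match goal with
  | |- context [@cfun _ ?f t] => generalize (cfun f t); intro
  end; clear t; lra.

(** * Parity involution and the representation on densities *)

Section Densities.
Variable R : realType.
Local Notation superfun := (superfun R).
Local Notation L := Lie_density.
Implicit Types F G H K : superfun.

(** The p-th power of the parity involution: the sign (-1)^(p |F|) F of the
    Koszul rule, extended linearly to all F. *)
Definition parity_pow (p : bool) F :=
  if p then SuperFun (sf0 F) (- sf1 F) else F.

Lemma parity_powD p F G : parity_pow p (F + G) = parity_pow p F + parity_pow p G.
Proof. by case: p => //; apply: superfunP => //; exact: opprD. Qed.

Lemma parity_powN p F : parity_pow p (- F) = - parity_pow p F.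
Proof. by case: p => //; apply: superfunP. Qed.

Lemma parity_powZ p k F : parity_pow p (k *: F) = k *: parity_pow p F.
Proof. by case: p => //; apply: superfunP => //; rewrite /= scalerN. Qed.

Lemma parity_powC p q F :
  parity_pow p (parity_pow q F) = parity_pow q (parity_pow p F).
Proof. by case: p q => [] []. Qed.

Lemma parity_pow_addb p q F :
  parity_pow (p (+) q) F = parity_pow p (parity_pow q F).
Proof. by case: p q => [] [] //=; apply: superfunP; rewrite /= ?opprK. Qed.

Lemma parity_powE p F :
  parity_pow p F = sfpart false F + (-1) ^+ p *: sfpart true F.
Proof.
by case: p; apply: superfunP;
  rewrite /= ?(expr1, scaleN1r, scale1r, scaler0, oppr0, addr0, add0r).
Qed.

Lemma sfpart_sum F : sfpart true F + sfpart false F = F.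
Proof. by apply: superfunP; rewrite /= ?add0r ?addr0. Qed.

Lemma sfpart_part p q F :
  sfpart p (sfpart q F) = if p == q then sfpart q F else 0.
Proof. by case: p q => [] []. Qed.

Lemma sfpart0 p : sfpart p (0 : superfun) = 0.
Proof. by case: p. Qed.

Lemma Lie_densityE a H F : L a H F = SuperFun
  (sf0 H * cderiv (sf0 F) + 2^-1 *: (sf1 H * sf1 F)
   + a *: (cderiv (sf0 H) * sf0 F))
  (sf0 H * cderiv (sf1 F)
   + 2^-1 *: (sf1 H * cderiv (sf0 F) + cderiv (sf0 H) * sf1 F)
   + a *: (cderiv (sf0 H) * sf1 F + cderiv (sf1 H) * sf0 F)).
Proof.
rewrite /Lie_density /contact_field /eta /etabar /dtheta /dx /stheta.
by case: H F => [h0 h1] [f0 f1]; superfun_ring.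
Qed.

Lemma contact_bracketE H K : contact_bracket H K = SuperFun
  (sf0 H * cderiv (sf0 K) - cderiv (sf0 H) * sf0 K + 2^-1 *: (sf1 H * sf1 K))
  (sf0 H * cderiv (sf1 K) - 2^-1 *: (cderiv (sf0 H) * sf1 K)
   + 2^-1 *: (sf1 H * cderiv (sf0 K)) - cderiv (sf1 H) * sf0 K).
Proof.
rewrite /contact_bracket /eta /etabar /dtheta /dx /stheta.
by case: H K => [h0 h1] [k0 k1]; superfun_ring.
Qed.

Lemma Lie_density_sfpart a p H F : L a (sfpart p H) F =
  if p then SuperFun (2^-1 *: (sf1 H * sf1 F))
    (2^-1 *: (sf1 H * cderiv (sf0 F)) + a *: (cderiv (sf1 H) * sf0 F))
  else SuperFun (sf0 H * cderiv (sf0 F) + a *: (cderiv (sf0 H) * sf0 F))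
    (sf0 H * cderiv (sf1 F) + (a + 2^-1) *: (cderiv (sf0 H) * sf1 F)).
Proof.
by case: p H F => [] [h0 h1] [f0 f1]; rewrite Lie_densityE; superfun_ring.
Qed.

Lemma contact_bracket_sfpart p q H K :
  contact_bracket (sfpart p H) (sfpart q K) = sfpart (p (+) q) (SuperFun
    (if p then 2^-1 *: (sf1 H * sf1 K)
     else sf0 H * cderiv (sf0 K) - cderiv (sf0 H) * sf0 K)
    (if p then 2^-1 *: (sf1 H * cderiv (sf0 K)) - cderiv (sf1 H) * sf0 K
     else sf0 H * cderiv (sf1 K) - 2^-1 *: (cderiv (sf0 H) * sf1 K))).
Proof.
by case: p q H K => [] [] [h0 h1] [k0 k1];
  rewrite contact_bracketE; superfun_ring.
Qed.

Lemma Lie_density_linear a H : linear (L a H).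
Proof. by move=> k F G; rewrite !Lie_densityE; superfun_ring. Qed.

Lemma Lie_density_linearl a F : linear (fun H => L a H F).
Proof. by move=> k H K; rewrite !Lie_densityE; superfun_ring. Qed.

Lemma Lie_densityD a H F G : L a H (F + G) = L a H F + L a H G.
Proof. by have [] := linear_morph _ (Lie_density_linear a H). Qed.

Lemma Lie_densityZ a H k F : L a H (k *: F) = k *: L a H F.
Proof. by have [] := linear_morph _ (Lie_density_linear a H). Qed.

Lemma Lie_density0l a F : L a 0 F = 0.
Proof. by have [] := linear_morph _ (Lie_density_linearl a F). Qed.

Lemma Lie_density_parity_pow a p q H F :
  L a (sfpart p H) (parity_pow q F) =
  (-1) ^+ (p && q) *: parity_pow q (L a (sfpart p H) F).
Proof.
by case: p q H F => [] [] [h0 h1] [f0 f1];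
  rewrite /parity_pow /sfpart /andb ?expr1 ?expr0 !Lie_densityE; superfun_ring.
Qed.

Lemma Lie_density_bracket a p q H K F :
  L a (sfpart p H) (L a (sfpart q K) F)
  - (-1) ^+ (p && q) *: L a (sfpart q K) (L a (sfpart p H) F)
  = L a (contact_bracket (sfpart p H) (sfpart q K)) F.
Proof.
rewrite contact_bracket_sfpart !Lie_density_sfpart.
by case: p q H K F => [] [] [h0 h1] [k0 k1] [f0 f1];
  rewrite ?expr0 ?expr1 /addb /andb; superfun_ring.
Qed.

End Densities.
Arguments parity_pow {R}.

(** * Relative cohomology of osp(1|2)-modules *)

Section RelativeCocycles.
Variable R : realType.
Local Notation osp12 := (osp12 R).
Local Notation superfun := (superfun R).

Definition homogeneous p (g : osp12) := osp12_part p g = g.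

(** The cocycle condition on homogeneous elements, for an operation D that is
    the action of g composed with a power of the parity involution: the parity
    of Y is absorbed in D. That [D^~ v] is a cocycle for each v says that D comes
    from a representation. *)
Definition signed_cocycle (V : lmodType R) (D : osp12 -> V -> V)
    (Y : osp12 -> V) :=
  linear Y /\
  forall p q g h, homogeneous p g -> homogeneous q h ->
    (-1) ^+ (p && q) *: D g (Y h) - D h (Y g) = Y (osp12_bracket g h).

Lemma even_in_osp12 (a b c : R) :
  SuperFun (a *: (1 : Cinf R) + b *: cX R + c *: (cX R * cX R)) 0
    \in @osp12_pred R.
Proof.
apply/asboolP; exists a, b, c, 0, 0.
by rewrite /sx /stheta !scale0r !addr0 expr2; superfun_ring.
Qed.

Lemma odd_in_osp12 (d e : R) :
  SuperFun 0 (d *: (1 : Cinf R) + e *: cX R) \in @osp12_pred R.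
Proof.
apply/asboolP; exists 0, 0, 0, d, e.
by rewrite /sx /stheta !scale0r !add0r; superfun_ring.
Qed.

Definition osp_even a b c : osp12 := MkOsp12 (even_in_osp12 a b c).
Definition osp_odd d e : osp12 := MkOsp12 (odd_in_osp12 d e).

Lemma osp12P (g : osp12) : exists a b c d e, g = osp_even a b c + osp_odd d e.
Proof.
have [a [b [c [d [e gE]]]]] := in_osp12_val g.
exists a, b, c, d, e; apply: val_inj; rewrite [LHS]gE.
transitivity (ospfun (osp_even a b c) + ospfun (osp_odd d e)); last by [].
by rewrite /sx /stheta expr2 /=; superfun_ring.
Qed.

Lemma osp_even_basis a b c : osp_even a b c =
  a *: osp_even 1 0 0 + (b *: osp_even 0 1 0 + c *: osp_even 0 0 1).
Proof.
apply: val_inj; transitivity (a *: ospfun (osp_even 1 0 0)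
  + (b *: ospfun (osp_even 0 1 0) + c *: ospfun (osp_even 0 0 1))); last by [].
by rewrite /=; superfun_ring.
Qed.

Lemma osp_odd_basis d e :
  osp_odd d e = d *: osp_odd 1 0 + e *: osp_odd 0 1.
Proof.
apply: val_inj; transitivity
  (d *: ospfun (osp_odd 1 0) + e *: ospfun (osp_odd 0 1)); last by [].
by rewrite /=; superfun_ring.
Qed.

Lemma bracket_even_odd a b c d e :
  osp12_bracket (osp_even a b c) (osp_odd d e) =
  osp_odd (a * e - b * d / 2) (b * e / 2 - c * d).
Proof. by apply: val_inj; rewrite /= contact_bracketE; superfun_ring. Qed.

Lemma bracket_odd_odd d e d' e' :
  osp12_bracket (osp_odd d e) (osp_odd d' e') =
  osp_even (d * d' / 2) ((d * e' + e * d') / 2) (e * e' / 2).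
Proof. by apply: val_inj; rewrite /= contact_bracketE; superfun_ring. Qed.

Lemma osp_even_homogeneous a b c : homogeneous false (osp_even a b c).
Proof. exact: val_inj. Qed.

Lemma osp_odd_homogeneous d e : homogeneous true (osp_odd d e).
Proof. exact: val_inj. Qed.

Lemma sl2P (g : osp12) : sl2 R g <-> exists a b c, g = osp_even a b c.
Proof.
have E a b c : ospfun (osp_even a b c) =
    a *: (1 : superfun) + b *: sx R + c *: sx R ^+ 2.
  by rewrite /sx expr2 /=; superfun_ring.
split=> [[a [b [c gE]]]|[a [b [c ->]]]]; exists a, b, c; last exact: E.
by apply: val_inj; rewrite [RHS]E.
Qed.

Lemma sl2_even (g : osp12) : sl2 R g -> homogeneous false g.
Proof. by move=> /sl2P[a [b [c ->]]]; exact: osp_even_homogeneous. Qed.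

(** The cochain Y is the coboundary of -4 times the contraction D_theta B of
    the doublet (A, B) = (Y theta, Y (x theta)). It is invariant since it is
    a contraction, and its coboundary is computed from the fact that D_theta and
    D_(x theta) square to -1/4 of D_1 and D_(x^2), with D_1 B = A and
    D_(x^2) A = - B. *)
Theorem relative_cocycle_coboundary (V : lmodType R) (D : osp12 -> V -> V)
    (Y : osp12 -> V) :
  (forall g, linear (D g)) ->
  (forall v, signed_cocycle V D (D^~ v)) ->
  signed_cocycle V D Y -> (forall g, sl2 R g -> Y g = 0) ->
  exists2 w, (forall g, sl2 R g -> D g w = 0) & forall g, Y g = D g w.
Proof.
move=> DL Dco [Ylin Yco] Y0.
have D0 g : D g 0 = 0 by have [] := linear_morph _ (DL g).
have DZ g k v : D g (k *: v) = k *: D g v.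
  by have [_ _] := linear_morph _ (DL g).
have DDl g h v : D (g + h) v = D g v + D h v.
  by have [/linear_morph[_ + _] _] := Dco v.
have DZl k g v : D (k *: g) v = k *: D g v.
  by have [/linear_morph[_ _ +] _] := Dco v.
have [_ YD YZ] := linear_morph _ Ylin.
have sl2_ev a b c : sl2 R (osp_even a b c) by apply/sl2P; exists a, b, c.
have Yeo a b c d e : D (osp_even a b c) (Y (osp_odd d e)) =
    Y (osp_odd (a * e - b * d / 2) (b * e / 2 - c * d)).
  have := Yco _ _ _ _ (osp_even_homogeneous a b c) (osp_odd_homogeneous d e).
  by rewrite (Y0 _ (sl2_ev a b c)) D0 subr0 scale1r bracket_even_odd.
have Yoo d e d' e' : D (osp_odd d e) (Y (osp_odd d' e')) =
    - D (osp_odd d' e') (Y (osp_odd d e)).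
  have := Yco _ _ _ _ (osp_odd_homogeneous d e) (osp_odd_homogeneous d' e').
  rewrite expr1 scaleN1r bracket_odd_odd (Y0 _ (sl2_ev _ _ _)).
  by move/subr0_eq/(canRL opprK).
have Deo a b c d e v : D (osp_even a b c) (D (osp_odd d e) v) =
    D (osp_odd d e) (D (osp_even a b c) v)
    + D (osp_odd (a * e - b * d / 2) (b * e / 2 - c * d)) v.
  have [_ /(_ _ _ _ _ (osp_even_homogeneous a b c) (osp_odd_homogeneous d e))]
    := Dco v.
  by rewrite scale1r bracket_even_odd => /(canRL (subrK _)) ->; rewrite addrC.
have Doo d e v : D (osp_odd d e) (D (osp_odd d e) v) =
    - 2^-1 *: D (osp_even (d * d / 2) (d * e) (e * e / 2)) v.
  have [_ /(_ _ _ _ _ (osp_odd_homogeneous d e) (osp_odd_homogeneous d e))]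
    := Dco v.
  rewrite expr1 scaleN1r bracket_odd_odd.
  have -> : (d * e + e * d) / 2 = d * e by field.
  move=> <-; rewrite scalerDr scaleNr !scalerN opprK -scalerDl.
  by rewrite -[2^-1]div1r -splitr scale1r.
pose A := Y (osp_odd 1 0); pose B := Y (osp_odd 0 1).
have D1B : D (osp_even 1 0 0) B = A.
  by rewrite Yeo !(mul0r, mul1r, mulr1, mulr0, subr0).
have DxB : D (osp_even 0 1 0) B = 2^-1 *: B.
  rewrite Yeo !(mul0r, mul1r, mulr1, mulr0, subr0).
  by rewrite osp_odd_basis scale0r add0r YZ.
have DxxB : D (osp_even 0 0 1) B = 0.
  rewrite Yeo !(mul0r, mul1r, mulr1, mulr0, subr0).
  by rewrite osp_odd_basis !scale0r addr0 -(scale0r (osp_odd 1 0)) YZ scale0r.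
have DevB a b c : D (osp_even a b c) B = a *: A + (b / 2) *: B.
  by rewrite osp_even_basis !DDl !DZl D1B DxB DxxB scaler0 addr0 scalerA.
have DxthB : D (osp_odd 0 1) B = 0.
  have := Yoo 0 1 0 1; rewrite -/B => /eqP.
  rewrite -addr_eq0 -mulr2n -scaler_nat.
  by rewrite scaler_eq0 pnatr_eq0 => /eqP.
have DthA : D (osp_odd 1 0) A = 0.
  have := Yoo 1 0 1 0; rewrite -/A => /eqP.
  rewrite -addr_eq0 -mulr2n -scaler_nat.
  by rewrite scaler_eq0 pnatr_eq0 => /eqP.
have DxthA : D (osp_odd 0 1) A = - D (osp_odd 1 0) B by rewrite Yoo.
pose w := - 4 *: D (osp_odd 1 0) B.
have w_inv g : sl2 R g -> D g w = 0.
  move=> /sl2P [a [b [c ->]]].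
  rewrite DZ Deo DevB.
  have -> : D (osp_odd 1 0) (a *: A + (b / 2) *: B) =
      (b / 2) *: D (osp_odd 1 0) B.
    by rewrite DL DthA scaler0 add0r DZ.
  rewrite (osp_odd_basis (_ - _)) DDl !DZl DxthB scaler0 addr0 -scalerDl.
  have -> : b / 2 + (a * 0 - b * 1 / 2) = 0 by ring.
  by rewrite scale0r scaler0.
exists w => // g; have [a [b [c [d [e ->]]]]] := osp12P g.
rewrite YD DDl (Y0 _ (sl2_ev _ _ _)) (w_inv _ (sl2_ev _ _ _)) !add0r.
rewrite (osp_odd_basis d) YD !YZ DDl !DZl; congr (_ *: _ + _ *: _).
  rewrite DZ Doo DevB !(mulr0, mul0r, scale0r, addr0) !scalerA -[LHS]scale1r.
  by congr (_ *: _); field.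
(* For D_(x theta), the other expression of the contraction is the useful one. *)
have -> : w = 4 *: D (osp_odd 0 1) A by rewrite DxthA scalerN -scaleNr.
rewrite DZ Doo Yeo !(mulr0, mul0r, subr0, sub0r, oppr0).
rewrite (osp_odd_basis 0 (- _)) scale0r add0r YZ !scalerA -[LHS]scale1r.
by congr (_ *: _); field.
Qed.

End RelativeCocycles.

(** * Bidifferential operators and their homogeneous parts *)

Section Bidifferential.
Variable R : realType.
Local Notation superfun := (superfun R).
Local Notation bidiffop := (bidiffop R).
Implicit Types (F G H : superfun) (A v : bidiffop).
Local Arguments sfpart : simpl never.

Lemma sderZ i a k F : sder i a (k *: F) = k *: sder i a F.
Proof. by case: a; rewrite /sder ?dthetaZ; elim: i => //= i ->; rewrite dxZ. Qed.

Lemma superfun_scalerAl k F G : (k *: F) * G = k *: (F * G).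
Proof. by rewrite sf_scaleM -mulrA -sf_scaleM. Qed.

Lemma superfun_scalerAr k F G : F * (k *: G) = k *: (F * G).
Proof. by rewrite mulrC superfun_scalerAl mulrC. Qed.

Lemma is_bidiff_linearl (B : superfun -> superfun -> superfun) G :
  is_bidiff B -> linear (fun F => B F G).
Proof.
move=> [N [c cB]] k F F'; rewrite !cB.
do 4![rewrite scaler_sumr -big_split; apply: eq_bigr => ? _] => /=.
by rewrite sderD sderZ mulrDr mulrDl superfun_scalerAr superfun_scalerAl.
Qed.

Lemma bidiff_linearl A G : linear (A^~ G).
Proof. exact: is_bidiff_linearl (bidiffop_bidiff A). Qed.

Lemma bidiff_linearr A F : linear (A F).
Proof. exact: is_bidiff_linearl (is_bidiff_swap (bidiffop_bidiff A)). Qed.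

Lemma bidiff0l A G : A 0 G = 0.
Proof. by have [] := linear_morph _ (bidiff_linearl A G). Qed.

Lemma bidiff0r A F : A F 0 = 0.
Proof. by have [] := linear_morph _ (bidiff_linearr A F). Qed.

Lemma bidiffDl A F F' G : A (F + F') G = A F G + A F' G.
Proof. by have [] := linear_morph _ (bidiff_linearl A G). Qed.

Lemma bidiffDr A F G G' : A F (G + G') = A F G + A F G'.
Proof. by have [] := linear_morph _ (bidiff_linearr A F). Qed.

Lemma bidiffNl A F G : A (- F) G = - A F G.
Proof.
have [_ _ AZ] := linear_morph _ (bidiff_linearl A G).
by rewrite -scaleN1r AZ scaleN1r.
Qed.

Lemma bidiffNr A F G : A F (- G) = - A F G.
Proof.
have [_ _ AZ] := linear_morph _ (bidiff_linearr A F).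
by rewrite -scaleN1r AZ scaleN1r.
Qed.

Lemma bidiff_part_part p q A :
  bidiff_part p (bidiff_part q A) = if p == q then bidiff_part q A else 0.
Proof.
apply: bidiffopP => F G.
transitivity (bimap_part p (bimap_part q A) F G); first by [].
rewrite {1}/bimap_part !big_bool /bimap_part !big_bool.
rewrite !sfpart_part /= !bidiff0l !bidiff0r !sfpart0 !addr0 !add0r !sfpart_part.
by case: p q => [] []; rewrite /= /bimap_part ?big_bool /= ?addr0 ?add0r.
Qed.

Lemma bidiff_part_sum A : \sum_(q : bool) bidiff_part q A = A.
Proof.
apply: bidiffopP => F G; rewrite big_bool.
rewrite -[RHS](congr2 (bdfun A) (sfpart_sum _ F) (sfpart_sum _ G)).
rewrite !(bidiffDl, bidiffDr).
rewrite -[LHS]/(bimap_part true A F G + bimap_part false A F G).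
rewrite /bimap_part !big_bool /addb /negb.
rewrite -[X in _ = X + _ + _]sfpart_sum -[X in _ = _ + X + _]sfpart_sum.
rewrite -[X in _ = _ + (X + _)]sfpart_sum -[X in _ = _ + (_ + X)]sfpart_sum /=.
ring.
Qed.

(** The Koszul signs that the homogeneous parts of an operator carry amount to
    conjugating the operator by the parity involution. *)
Lemma bidiff_part_sign p A F G :
  \sum_(q : bool) (-1) ^+ (p && q) *: bidiff_part q A F G =
  parity_pow p (A (parity_pow p F) (parity_pow p G)).
Proof.
case: p; last by rewrite -{2}(bidiff_part_sum A) !big_bool /andb !scale1r.
rewrite big_bool !parity_powE /andb expr1 expr0 !scaleN1r scale1r /=.
rewrite !(bidiffDl, bidiffDr, bidiffNl, bidiffNr).
rewrite /bimap_part !big_bool /addb /negb.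
move: (A _ _) (A _ _) (A _ _) (A _ _) => X Y Z T.
by rewrite /sfpart; superfun_ring.
Qed.

End Bidifferential.

(** * The coboundary of a 0-cochain *)

Section Coboundary.
Variable R : realType.
Variables lambda nu mu : R.
Local Notation superfun := (superfun R).
Local Notation osp12 := (osp12 R).
Local Notation bidiffop := (bidiffop R).
Local Notation act := (bidiff_act lambda nu mu).
Local Notation D := (delta0 lambda nu mu).
Local Notation L := Lie_density.
Implicit Types (F G H : superfun) (A v : bidiffop) (g h : osp12).
Local Arguments sfpart : simpl never.

Lemma sum_signed_parts p (V : lmodType R) (f : superfun -> V) F : linear f ->
  \sum_(s : bool) (-1) ^+ (p && s) *: f (sfpart s F) = f (parity_pow p F).
Proof.
move=> /linear_morph[_ fD fZ].
by rewrite big_bool parity_powE fD fZ andbT andbF scale1r addrC.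
Qed.

Lemma Lie_tensor_homogeneous p H A F G :
  Lie_tensor lambda nu (sfpart p H) A F G =
  A (L lambda (sfpart p H) F) G
  + A (parity_pow p F) (L nu (sfpart p H) G).
Proof.
rewrite /Lie_tensor (sum_bool_single _ p) => [|q qp]; last first.
  rewrite sfpart_part qp big1 // => s _.
  by rewrite !Lie_density0l bidiff0l bidiff0r scaler0 addr0.
rewrite sfpart_part eqxx big_split; congr (_ + _).
  by rewrite big_bool /= -bidiffDl -Lie_densityD sfpart_sum.
by apply: (sum_signed_parts p _ (fun F => A F _)); exact: bidiff_linearl.
Qed.

Lemma act_homogeneous p g A F G : homogeneous R p g ->
  act g A F G = L mu g (A F G) - \sum_(q : bool) (-1) ^+ (p && q) *:
    (bidiff_part q A (L lambda g F) G
     + bidiff_part q A (parity_pow p F) (L nu g G)).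
Proof.
move=> gp; have -> : ospfun g = sfpart p g by rewrite -[in LHS]gp.
rewrite -[LHS]/(Lie_bimap lambda nu mu g A F G) /Lie_bimap.
rewrite (sum_bool_single _ p) => [|p' pp]; last first.
  rewrite -gp sfpart_part pp big1 // => q _.
  have := Lie_tensor_homogeneous true 0 (bidiff_part q A) F G.
  rewrite sfpart0 !Lie_density0l bidiff0l bidiff0r addr0 => S0.
  by rewrite [Lie_tensor _ _ _ _ _ _]S0 scaler0 subr0.
rewrite sumrB; congr (_ - _).
  rewrite -[in RHS](bidiff_part_sum R A) !big_bool /=.
  exact: esym (Lie_densityD _ _ _ _ _).
apply: eq_bigr => q _; congr (_ *: _).
exact: (Lie_tensor_homogeneous p g (bidiff_part q A)).
Qed.

Lemma osp12_part_part p q g :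
  osp12_part p (osp12_part q g) = if p == q then osp12_part q g else 0.
Proof. by apply: val_inj; rewrite /= sfpart_part; case: eqP. Qed.

Lemma osp12_part_homogeneous p g : homogeneous R p (osp12_part p g).
Proof. by rewrite /homogeneous osp12_part_part eqxx. Qed.

Lemma ospfun0 : ospfun (0 : osp12) = 0.
Proof. by []. Qed.

Lemma homogeneous0 p : homogeneous R p 0.
Proof. by apply: val_inj; exact: sfpart0. Qed.

Lemma act0l A : act 0 A = 0.
Proof.
apply: bidiffopP => F G; rewrite (act_homogeneous _ _ _ _ _ (homogeneous0 false)).
rewrite ospfun0 !Lie_density0l big1 ?subr0 // => q _.
by rewrite bidiff0l bidiff0r addr0 scaler0.
Qed.

(** Conjugation of A by the p-th power of the parity involution, followed by the
    action of an element of parity p. The family T stands for the representations on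
    densities of all weights; keeping it abstract lets the commutator of two
    such operations be computed from a few rules. *)
Definition twisted_action p (T : R -> superfun -> superfun)
    (A : superfun -> superfun -> superfun) F G :=
  T mu (parity_pow p (A (parity_pow p F) (parity_pow p G)))
  - A (T lambda F) G - A (parity_pow p F) (T nu G).

Lemma delta0_sum p v g : homogeneous R p g ->
  D v g = \sum_(r : bool) (-1) ^+ (p && r) *: act g (bidiff_part r v).
Proof.
move=> gp; rewrite /delta0 (sum_bool_single _ p) ?gp // => q qp.
by rewrite -gp osp12_part_part qp big1 // => r _; rewrite act0l scaler0.
Qed.

Lemma delta0_homogeneous p v g F G : homogeneous R p g ->
  D v g F G = twisted_action p (fun a => L a g) v F G.
Proof.
move=> gp; rewrite (delta0_sum _ _ _ gp).
have evalS (f : bool -> bidiffop) F' G' :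
    (\sum_(r : bool) f r) F' G' = \sum_(r : bool) f r F' G'.
  by rewrite !big_bool.
have evalZ k A F' G' : (k *: A) F' G' = k *: A F' G' by [].
have actE r : act g (bidiff_part r v) F G = L mu g (bidiff_part r v F G)
    - (-1) ^+ (p && r) *: (bidiff_part r v (L lambda g F) G
                           + bidiff_part r v (parity_pow p F) (L nu g G)).
  rewrite (act_homogeneous _ _ _ _ _ gp) (sum_bool_single _ r) => [|q qr].
    by rewrite bidiff_part_part eqxx.
  by rewrite bidiff_part_part qr addr0 scaler0.
transitivity (\sum_(r : bool) ((-1) ^+ (p && r) *: L mu g (bidiff_part r v F G)
   - (bidiff_part r v (L lambda g F) G
      + bidiff_part r v (parity_pow p F) (L nu g G)))).
  rewrite evalS; apply: eq_bigr => r _.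
  by rewrite evalZ actE scalerBr scalerA -expr2 sqrr_sign scale1r.
rewrite sumrB big_split opprD addrA; congr (_ - _ - _).
- by rewrite -bidiff_part_sign !big_bool Lie_densityD !Lie_densityZ.
- by rewrite -evalS bidiff_part_sum.
- by rewrite -evalS bidiff_part_sum.
Qed.

Lemma delta0_parts v g : D v g = \sum_(p : bool) D v (osp12_part p g).
Proof.
apply: eq_bigr => p _.
by rewrite (delta0_sum _ _ _ (osp12_part_homogeneous p g)).
Qed.

Lemma delta0_even v g : homogeneous R false g -> D v g = act g v.
Proof.
move=> g0; apply: bidiffopP => F G; rewrite (delta0_homogeneous _ _ _ _ _ g0).
rewrite (act_homogeneous _ _ _ _ _ g0) /twisted_action -addrA -opprD.
congr (_ - _); rewrite -{1 2}(bidiff_part_sum _ v) !big_bool !scale1r.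
exact: addrACA.
Qed.

Lemma delta0_linear v : linear (D v).
Proof.
move=> k g h; rewrite !(delta0_parts v) scaler_sumr -big_split.
apply: eq_bigr => p _; apply: bidiffopP => F G.
rewrite -[RHS]/(k *: D v (osp12_part p g) F G + D v (osp12_part p h) F G).
rewrite !(delta0_homogeneous _ _ _ _ _ (osp12_part_homogeneous p _)).
have E : ospfun (osp12_part p (k *: g + h)) =
    k *: ospfun (osp12_part p g) + ospfun (osp12_part p h).
  by apply: superfunP; case: p; rewrite /sfpart /= ?scaler0 ?addr0.
rewrite /twisted_action E !(Lie_density_linearl R _ _ k).
rewrite (bidiff_linearl _ v _ k) (bidiff_linearr _ v _ k).
by rewrite sub2_addACA !scalerBr.
Qed.

Lemma delta0_linear_cochain g : linear (D^~ g).
Proof.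
move=> k v w; rewrite !(delta0_parts _ g) scaler_sumr -big_split.
apply: eq_bigr => p _; apply: bidiffopP => F G.
rewrite -[RHS]/(k *: D v (osp12_part p g) F G + D w (osp12_part p g) F G).
rewrite !(delta0_homogeneous _ _ _ _ _ (osp12_part_homogeneous p g)).
have E F' G' : (k *: v + w) F' G' = k *: v F' G' + w F' G' by [].
rewrite /twisted_action !E parity_powD parity_powZ Lie_density_linear.
by rewrite sub2_addACA !scalerBr.
Qed.

(** S and T have parities p and q, in the sense that they commute with the
    parity involution up to sign. The mixed terms cancel and only the
    supercommutator of S and T acts, in each of the three slots. *)
Lemma twisted_action_bracket p q (S T : R -> superfun -> superfun) v F G
    (s : R := (-1) ^+ (p && q)) :
  (forall a, linear (S a)) -> (forall a, linear (T a)) ->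
  (forall a X, S a (parity_pow q X) = s *: parity_pow q (S a X)) ->
  (forall a X, T a (parity_pow p X) = s *: parity_pow p (T a X)) ->
  s *: twisted_action p S (twisted_action q T v) F G
  - twisted_action q T (twisted_action p S v) F G =
  twisted_action (p (+) q) (fun a X => S a (T a X) - s *: T a (S a X)) v F G.
Proof.
move=> Slin Tlin Sq Tp.
have SD a X Y : S a (X + Y) = S a X + S a Y.
  by have [] := linear_morph _ (Slin a).
have TD a X Y : T a (X + Y) = T a X + T a Y.
  by have [] := linear_morph _ (Tlin a).
have SN a X : S a (- X) = - S a X.
  by have [_ _ SZ] := linear_morph _ (Slin a); rewrite -scaleN1r SZ scaleN1r.
have TN a X : T a (- X) = - T a X.
  by have [_ _ TZ] := linear_morph _ (Tlin a); rewrite -scaleN1r TZ scaleN1r.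
have sP : s = 1 \/ s = -1 by rewrite /s; case: (p && q); [right|left].
have ss : s * s = 1 by rewrite -expr2 /s sqrr_sign.
have pT a X : parity_pow p (T a X) = s *: T a (parity_pow p X).
  by rewrite Tp scalerA ss scale1r.
have qS a X : parity_pow q (S a X) = s *: S a (parity_pow q X).
  by rewrite Sq scalerA ss scale1r.
(* Both sides are brought to the same normal form: the involutions are moved
   inside S mu and T mu, but outside S and T applied to the arguments F and G. *)
rewrite /twisted_action !parity_pow_addb !(parity_powC R q p).
rewrite !(parity_powD, parity_powN).
rewrite [parity_pow p (T mu (parity_pow q _))]pT.
rewrite [parity_pow q (S mu (parity_pow p _))]qS !(parity_powC R q p).
rewrite !(Tp lambda F) !(Tp nu G) !(Sq lambda F) !(Sq nu G).
by case: sP => ->; rewrite ?scale1r ?scaleN1r;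
  rewrite !(bidiffDl, bidiffDr, bidiffNl, bidiffNr);
  rewrite !(parity_powN, parity_powD, SD, TD, SN, TN); ring.
Qed.

Lemma delta0_bracket v p q g h : homogeneous R p g -> homogeneous R q h ->
  (-1) ^+ (p && q) *: D (D v h) g - D (D v g) h = D v (osp12_bracket g h).
Proof.
move=> pg qh.
have pqgh : homogeneous R (p (+) q) (osp12_bracket g h).
  by apply: val_inj; rewrite /= -pg -qh contact_bracket_sfpart sfpart_part eqxx.
have br a F' : L a (osp12_bracket g h) F' =
    L a g (L a h F') - (-1) ^+ (p && q) *: L a h (L a g F').
  by rewrite /= -pg -qh -Lie_density_bracket.
apply: bidiffopP => F G.
rewrite -[LHS]/(_ *: D (D v h) g F G - D (D v g) h F G).
rewrite (delta0_homogeneous _ _ _ _ _ pg) (delta0_homogeneous _ _ _ _ _ qh).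
rewrite (delta0_homogeneous _ _ _ _ _ pqgh).
transitivity (twisted_action (p (+) q)
  (fun a X => L a g (L a h X) - (-1) ^+ (p && q) *: L a h (L a g X)) v F G);
  last by rewrite /twisted_action !br.
rewrite -(twisted_action_bracket p q (fun a => L a g) (fun a => L a h));
  first last.
- by move=> a X; rewrite -qh Lie_density_parity_pow andbC.
- by move=> a X; rewrite -pg Lie_density_parity_pow.
- by move=> a; exact: Lie_density_linear.
- by move=> a; exact: Lie_density_linear.
congr (_ *: _ - _); rewrite /twisted_action.
  by rewrite !(delta0_homogeneous _ _ _ _ _ qh).
by rewrite !(delta0_homogeneous _ _ _ _ _ pg).
Qed.

(** * Cocycles with values in bidifferential operators *)

Lemma cochain_part_homogeneous q r (Y : osp12 -> bidiffop) h : linear Y ->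
  homogeneous R q h -> cochain_part r Y h = bidiff_part (r (+) q) (Y h).
Proof.
move=> /linear_morph[Y0 _ _] hq.
rewrite /cochain_part (sum_bool_single _ q) ?hq // => p pq.
by rewrite -hq osp12_part_part pq Y0 bidiff_part0.
Qed.

(** The part of Y of parity r maps h to the part of Y h of parity r + q. Summing
    over the parity of Y h instead of that of Y turns the signs of the
    coboundary formula into those of delta0. *)
Lemma delta1_homogeneous p q (Y : osp12 -> bidiffop) g h : linear Y ->
  homogeneous R p g -> homogeneous R q h ->
  delta1 lambda nu mu Y g h =
  (-1) ^+ (p && q) *: D (Y h) g - D (Y g) h - Y (osp12_bracket g h).
Proof.
move=> Ylin gp hq; have [Y0 _ _] := linear_morph _ Ylin.
have c0 r : cochain_part r Y 0 = 0.
  rewrite (cochain_part_homogeneous true) ?Y0 ?bidiff_part0 //.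
  exact: homogeneous0.
rewrite /delta1; congr (_ - _).
rewrite (sum_bool_single _ p) => [|p' pp]; last first.
  rewrite -gp osp12_part_part pp big1 // => q' _; rewrite big1 // => r _.
  by rewrite act0l c0 bidiff_act0 !scaler0 subr0.
rewrite gp (sum_bool_single _ q) => [|q' qq]; last first.
  rewrite -hq osp12_part_part qq big1 // => r _.
  by rewrite act0l c0 bidiff_act0 !scaler0 subr0.
rewrite hq sumrB (delta0_sum _ _ _ gp) (delta0_sum _ _ _ hq); congr (_ - _).
  rewrite -[in RHS](sum_addb _ q) scaler_sumr; apply: eq_bigr => r _.
  rewrite (cochain_part_homogeneous q) // scalerA; congr (_ *: _).
  rewrite -signr_addb; congr (_ ^+ (nat_of_bool _)).
  by case: p q r {gp hq} => [] [] [].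
rewrite -[RHS](sum_addb _ p); apply: eq_bigr => r _.
by rewrite (cochain_part_homogeneous p) // addbC.
Qed.

Lemma cocycle1_signed k Y : is_cocycle1 lambda nu mu k Y ->
  signed_cocycle R bidiffop (fun g v => D v g) Y.
Proof.
move=> [[Ylin _ _ _] Yco]; split=> // p q g h gp hq.
by have := Yco g h; rewrite (delta1_homogeneous p q) // => /subr0_eq.
Qed.

Lemma delta0_signed v : signed_cocycle R bidiffop (fun g v => D v g) (D v).
Proof.
by split=> [|p q g h gp hq]; [exact: delta0_linear|exact: delta0_bracket].
Qed.

Lemma cocycle_vanishing_on_sl2 Y :
  signed_cocycle R bidiffop (fun g v => D v g) Y ->
  (forall g, sl2 R g -> Y g = 0) ->
  exists2 w, is_cochain0 lambda nu mu (sl2 R) w & Y = D w.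
Proof.
move=> Yco Y0.
have [w w0 Yw] := relative_cocycle_coboundary R bidiffop (fun g v => D v g) Y
  delta0_linear_cochain delta0_signed Yco Y0.
exists w; last exact/funext.
by move=> g gs; rewrite -delta0_even ?w0 //; exact: sl2_even.
Qed.

End Coboundary.

Theorem proposition3p6 (R : realType) (lambda nu mu : R) :
  (forall c : H1 lambda nu mu (sl2 R), c = 0) /\
  (forall Y : osp12 R -> bidiffop R,
     is_cocycle1 lambda nu mu [set 0] Y ->
     (is_coboundary1 lambda nu mu [set 0] Y <->
      is_coboundary1_on lambda nu mu (sl2 R) Y)).
Proof.
split.
  elim/quotW => Y.
  have /asboolP Yco := valP Y.
  have [[_ _ Y0 _] _] := Yco.
  have Ycob := cocycle_vanishing_on_sl2 R lambda nu mu Y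
    (cocycle1_signed _ _ _ _ _ _ Yco) Y0.
  rewrite -[RHS]pi_zeror; apply/eqP; rewrite -Quotient.idealrBE subr0.
  exact/asboolP.
move=> Y Yco; split=> [[v _ ->]|[v Yv]]; first by exists v.
have [Ylin Ycyc] := cocycle1_signed _ _ _ _ _ _ Yco.
have [Dlin Dcyc] := delta0_signed _ lambda nu mu v.
have [] := cocycle_vanishing_on_sl2 _ lambda nu mu
  (fun g => Y g - delta0 lambda nu mu v g).
- split=> [k g h|p q g h gp hq]; first by rewrite Ylin Dlin scalerBr opprD addrACA.
  rewrite -(Ycyc _ _ _ _ gp hq) -(Dcyc _ _ _ _ gp hq) !delta0B scalerBr.
  by rewrite !opprD !opprK addrACA.
- by move=> g /Yv ->; rewrite subrr.
move=> w _ /funeqP Zw; exists (w + v); first by move=> _ ->; rewrite act0l.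
apply/funext => g; have := Zw g => /(canRL (subrK _)) ->.
by have /linear_morph[_ -> _] := delta0_linear_cochain R lambda nu mu g.
Qed.
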